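(* Assume that the continuum hypothesis fails, i.e., $2^{\aleph_0}>\aleph_1$. Then for every Abelian group $(G,+)$ of size $\aleph_2$, there exists a coloring $c:G\rightarrow\mathbb N$ such that for every uncountable $X\subseteq G$ and every $i\in\mathbb N$, there are three distinct elements $x,y,z$ of $X$ such that $c(x+y+z)=i$.
   Context: The ambient theory is ZFC. *)

(* Defs.v *)
From mathcomp Require Import all_boot all_algebra.
From mathcomp Require Import boolp classical_sets functions cardinality.

Set Implicit Arguments.
Unset Strict Implicit.
Unset Printing Implicit Defensive.

Local Open Scope classical_set_scope.
Local Open Scope card_scope.

Definition card_lt T U (A : set T) (B : set U) : Prop :=
  A #<= B /\ ~ (B #<= A).

(* [A] has the least cardinality strictly above that of [B]; the competitors
   [C] range over the sets of all types. *)
Definition card_succ T U (B : set U) (A : set T) : Prop :=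
  card_lt B A /\ forall (V : Type) (C : set V), card_lt B C -> A #<= C.

(* [has_aleph n A]: the set [A] has cardinality aleph_n. There is no type of
   cardinals, so the finite alephs are predicates on sets, obtained from the
   cardinality of [nat] by iterating the successor. *)
Fixpoint has_aleph (n : nat) (T : Type) (A : set T) : Prop :=
  match n with
  | 0 => A #= [set: nat]
  | m.+1 => exists (U : Type) (B : set U), has_aleph m B /\ card_succ B A
  end.

(* Main.v *)
Require Import Defs.
From HB Require Import structures.
From mathcomp Require Import all_boot all_order all_algebra.
From mathcomp Require Import finmap zify.
From mathcomp Require Import boolp classical_sets functions cardinality.
From mathcomp Require wochoice.

(** Fix a well-order of type omega_2 on the indices of a family of generators
    of G.  Every element of G has a unique normal form, a finite sum of
    multiples of generators, and normal forms of elements with disjoint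
    supports simply add up ([normal_unique], [tsum_fsetU]).  By a Delta-system
    argument an uncountable X contains elements b + x, with x ranging over
    uncountably many elements of pairwise disjoint supports, so that the
    support of (b + x) + (b + y) + (b + z) is the union of a fixed finite set
    R and of the supports of x, y and z ([group_colouring]).  It remains to
    colour the finite sets of ordinals below omega_2 in such a way that these
    unions take all colours ([all_colours]).

    The failure of the continuum hypothesis gives distinct reals r_w for
    w < omega_2.  They single out three ordinals of a finite set F: the two
    ordinals l < g for which the common prefix of r_l and r_g has the largest
    code, and the t for which r_t is then closest to r_g ([selects]).  When
    F = R u x u y u z and x is very close to y, the ordinals l, g and t sit at
    the same place in x, y and z ([decode_spec]).  So triples of ordinals have
    to be coloured.

    This uses a function rho from pairs below omega_2 to omega_1 with countable
    balls and two ultrametric inequalities ([subadditive_exists]).  Write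
    height(a, b) for the rank of b in the tree order of radius rho(a, b).  Every
    increasing omega_1-sequence u in omega_2 has a subsequence of one of three
    kinds ([trichotomy]).

    - Spread: for some t, height(t, u_x) is injective in x.
    - Diverging: for each x, height(u_x, u_y) is bounded in y, but rho is
      unbounded on every uncountable part of u.
    - Confined: the values of rho on u lie below some nu < omega_1, and the
      ranks for radii below nu are bounded by some mu < omega_1.

    In the first two cases one point above a suitable dl < omega_1 and many
    points below it produce countable ordinals A < dl <= B with A arbitrarily
    close to dl.  Enumerate B by natural numbers: for large n, dl is the least
    ordinal that is at least A and has number at most n.  A partition of omega_1
    into stationary sets then decides the colour, and n, which has to be large
    and free of t, is the code of the common prefix of the reals of l and g
    ([marker_colouring], [spread_winning], [diverging_winning]).  In the
    confined case no value in omega_1 is available, and the colour comes from an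
    oscillation.  The trace of g from l is the finite set of left-to-right
    minima of rho( . , g) on the interval [l, g].  Pressing down gives points
    whose traces can be prolonged on the right by clusters placed beyond any
    given bound ([step], [levels]).  Prolonging the traces of g and t in turn,
    the number of alternations between them grows by one at a time ([play]), so
    it runs through long intervals of integers, and its 2-adic valuation takes
    all values ([confined_colours]).  The position of t with respect to l < g
    tells which of the three rules applies ([triple_colour]). *)

Set Implicit Arguments.
Unset Strict Implicit.
Unset Printing Implicit Defensive.

Import Order.TTheory.

Local Open Scope classical_set_scope.

(** * Well-orders of type omega_1 and stationary sets *)

Definition wf_order d (T : porderType d) : Prop :=
  well_founded (fun x y : T => (x < y)%O).

(** Up to isomorphism, the first uncountable ordinal. *)
Definition omega1_like d (O : orderType d) : Prop :=
  [/\ wf_order O, forall a : O, countable [set x : O | (x < a)%O]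
    & ~ countable [set: O]].

Lemma wf_min d (T : orderType d) (A : set T) : wf_order T -> A !=set0 ->
  exists2 x, A x & forall y, A y -> (x <= y)%O.
Proof.
move=> wfT [x0 Ax0]; apply: contrapT => nomin.
elim: (wfT x0) Ax0 => x _ IH Ax; apply: nomin; exists x => // y Ay.
by rewrite leNgt; apply/negP => /IH /(_ Ay).
Qed.

Lemma countable_fiber_img T U (f : T -> U) (A : set T) (B : set U) :
  countable B -> (forall x, A x -> B (f x)) ->
  (forall y, B y -> countable [set x | A x /\ f x = y]) -> countable A.
Proof.
move=> cB AB cf; apply: (@sub_countable _ _ _ (\bigcup_(y in B) [set x | A x /\ f x = y])).
  by apply: subset_card_le => x Ax; exists (f x); [exact: AB|].
by apply: bigcup_countable.
Qed.

Lemma inj_countable T U (f : T -> U) (A : set T) (B : set U) :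
  countable B -> (forall x, A x -> B (f x)) ->
  (forall x y, A x -> A y -> f x = f y -> x = y) -> countable A.
Proof.
move=> cB AB finj; apply: (countable_fiber_img cB AB) => y By.
have [[x [Ax fx]]|ne] := pselect (exists x, A x /\ f x = y); last first.
  suff -> : [set x | A x /\ f x = y] = set0 by exact: countable0.
  by rewrite -subset0 => x Hx; apply: ne; exists x.
apply: (@sub_countable _ _ _ [set x]); last exact: countable1.
by apply: subset_card_le => z [Az fz]; apply: finj => //; rewrite fz.
Qed.

Lemma choice_on (T U : Type) (A : set T) (R : T -> U -> Prop) :
  (forall x, A x -> exists y, R x y) ->
  U -> exists f : T -> U, forall x, A x -> R x (f x).
Proof.
move=> H u0; have /choice[f Hf] : forall x, exists y, A x -> R x y.
  move=> x; have [Ax|nAx] := pselect (A x); last by exists u0.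
  by have [y Ry] := H x Ax; exists y.
by exists f.
Qed.

Section Omega1.
Context {d : Order.disp_t} {O : orderType d} (hO : omega1_like O).
Local Open Scope order_scope.
Local Open Scope classical_set_scope.

Let wfO : wf_order O := let: And3 h _ _ := hO in h.
Let cO (a : O) : countable [set x : O | x < a].
Proof. by case: hO. Qed.
Let ncO : ~ countable [set: O].
Proof. by case: hO. Qed.

Lemma countable_lt (a : O) : countable [set x : O | x < a].
Proof. exact: cO. Qed.

Lemma countable_le (a : O) : countable [set x : O | x <= a].
Proof.
apply: (@sub_countable _ _ _ ([set x | x < a] `|` [set a])); last first.
  by apply: (@sub_countable _ _ _ (\bigcup_b (if b then [set x | x < a] else [set a])));
   [apply: subset_card_le => x [?|?]; [exists true|exists false]
   | apply: bigcup_countable => // -[] _; [exact: cO|exact: countable1]].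
by apply: subset_card_le => x /=; rewrite le_eqVlt => /orP[/eqP|]; [right|left].
Qed.

Lemma countable_bounded (A : set O) : countable A -> exists b, forall a, A a -> a < b.
Proof.
move=> cA; apply: contrapT => nb; apply: ncO.
apply: (@sub_countable _ _ _ (\bigcup_(a in A) [set x | x <= a])); last first.
  by apply: bigcup_countable => // a _; exact: countable_le.
apply: subset_card_le => b _; apply: contrapT => Hb; apply: nb; exists b => a Aa.
by rewrite ltNge; apply/negP => ba; apply: Hb; exists a.
Qed.

Lemma uncountable_unbounded (A : set O) : ~ countable A -> forall b, exists2 a, A a & b < a.
Proof.
move=> ncA b; apply: contrapT => H; apply: ncA.
apply: (@sub_countable _ _ _ [set x | x <= b]); last exact: countable_le.
by apply: subset_card_le => a Aa /=; rewrite leNgt; apply/negP => ab; apply: H; exists a.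
Qed.

Lemma unbounded_uncountable (A : set O) : (forall b, exists2 a, A a & b < a) -> ~ countable A.
Proof.
move=> H cA; have [b Hb] := countable_bounded cA.
by have [a Aa /ltW] := H b; rewrite leNgt Hb.
Qed.

Lemma omega1_pt : exists o : O, True.
Proof.
apply: contrapT => H; apply: ncO.
suff -> : [set: O] = set0 by exact: countable0.
by rewrite -subset0 => x _; apply: H; exists x.
Qed.

Lemma omega1_gt (x : O) : exists y, x < y.
Proof.
have [b Hb] := countable_bounded (countable1 x).
by exists b; exact: Hb.
Qed.

(** Recursion: each value is taken above the countably many earlier ones, so
    the enumeration is strictly increasing without being an isomorphism onto A. *)
Lemma increasing_enum (A : set O) : ~ countable A ->
  exists phi : O -> O, (forall x y, x < y -> phi x < phi y) /\ forall x, A (phi x).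
Proof.
move=> ncA; have [o _] := omega1_pt.
pose body (x : O) (rec : forall y, y < x -> O) : O :=
  xget o [set z | A z /\ forall y (yx : y < x), rec y yx < z].
pose phi := Fix wfO (fun _ => O) body.
have phiE x : phi x = xget o [set z | A z /\ forall y, y < x -> phi y < z].
  rewrite /phi Fix_eq //= => z f g fg; rewrite /body; congr xget.
  by apply/seteqP; split => w [Aw H]; split=> // y yz; rewrite (fg, =^~ fg).
have P x : A (phi x) /\ forall y, y < x -> phi y < phi x.
  rewrite [phi x]phiE; case: xgetP => [z _ []//|ne].
  have [b Hb] : exists b, forall a, (phi @` [set y | y < x]) a -> a < b.
    by apply: countable_bounded; apply: sub_countable (card_image_le _ _) (cO x).
  have [a Aa ba] := uncountable_unbounded ncA b.
  by case: (ne a); split => // y yx; apply: lt_trans ba; apply: Hb; exists y.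
by exists phi; split => [x y xy|x]; [case: (P y) => _; apply | case: (P x)].
Qed.

End Omega1.

Section Closed.
Context {d : Order.disp_t} {O : orderType d} (hO : omega1_like O).
Local Open Scope order_scope.
Local Open Scope classical_set_scope.

(** The closed points of F contain a club, and every club contains the closed
    points of some F.  The first clause removes the least element, which would
    be closed for every F. *)
Definition closed_pt (F : O -> O) (x : O) : Prop :=
  (exists y, y < x) /\ forall y, y < x -> F y < x.

(** Stationarity in the usual sense; working with closed points instead of
    clubs makes the diagonal intersection a matter of bounding countable sets. *)
Definition stationary (S : set O) : Prop := forall F, exists2 x, S x & closed_pt F x.

Lemma closed_pt_max F G x : closed_pt (fun y => Order.max (F y) (G y)) x <->
  closed_pt F x /\ closed_pt G x.
Proof.
split=> [[ne H]|[[ne HF] [_ HG]]].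
  by split; split=> // y /H; rewrite gt_max => /andP[].
by split=> // y yx; rewrite gt_max HF // HG.
Qed.

Lemma closed_pt_lb F b x : closed_pt (fun y => Order.max (F y) b) x -> closed_pt F x /\ b < x.
Proof.
move=> [[z zx] H]; split; last by have := H z zx; rewrite gt_max => /andP[].
by split; [exists z|move=> y /H; rewrite gt_max => /andP[]].
Qed.

Lemma stat_unbounded S F b : stationary S -> exists2 x, S x & closed_pt F x /\ b < x.
Proof. by move=> /(_ (fun y => Order.max (F y) b))[x Sx /closed_pt_lb]; exists x. Qed.

Lemma stat_gt (S : set O) b : stationary S -> stationary [set x | S x /\ b < x].
Proof.
by move=> sS F; have [x Sx [cx bx]] := stat_unbounded F b sS; exists x.
Qed.

Lemma stat_uncountable S : stationary S -> ~ countable S.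
Proof.
move=> sS; apply: (unbounded_uncountable hO) => b.
by have [x Sx [_ bx]] := stat_unbounded id b sS; exists x.
Qed.

Lemma stat_sub (S S' : set O) : S `<=` S' -> stationary S -> stationary S'.
Proof. by move=> SS sS F; have [x Sx] := sS F; exists x => //; exact: SS. Qed.

Lemma statI_closed S F : stationary S -> stationary (S `&` closed_pt F).
Proof.
move=> sS G; have [x Sx /closed_pt_max[]] := sS (fun y => Order.max (F y) (G y)).
by exists x.
Qed.

(** Iterate from any point a map that bounds F on initial segments; the
    supremum of the iterates is closed under F. *)
Lemma statT : stationary setT.
Proof.
move=> F; have [o _] := omega1_pt hO.
have HF a : exists b, a < b /\ forall y, y <= a -> F y < b.
  have [b Hb] := @countable_bounded _ _ hO (F @` [set y | y <= a])
    (sub_countable (card_image_le _ _) (countable_le hO a)).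
  have [c Hc] := @countable_bounded _ _ hO [set a] (countable1 a).
  exists (Order.max b c); split; first by rewrite lt_max (Hc a) // orbT.
  by move=> y ya; rewrite lt_max Hb //; exists y.
have /choice[g Hg] := HF.
pose s n := iter n g o.
have [b Hb] : exists b, forall a, (range s) a -> a < b.
  exact: (countable_bounded hO (sub_countable (card_image_le s setT) (countableP _))).
have [x sx xmin] := @wf_min _ _ [set b | forall a, (range s) a -> a < b]
   (let: And3 h _ _ := hO in h) (ex_intro _ b Hb).
exists x => //; split; first by exists (s 0); apply: sx; exists 0%N.
move=> y yx; have [[n yn]|Hn] := pselect (exists n, y <= s n).
  apply: lt_trans (sx _ (ex_intro2 _ _ n.+1 I erefl)).
  by have [_] := Hg (s n); apply.
have : x <= y.
  apply: xmin => _ [n _ <-]; rewrite ltNge; apply/negP => h; apply: Hn; by exists n.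
by rewrite leNgt yx.
Qed.

(** This is the normality of the club filter: H bounds all G y z with y and z
    below its argument. *)
Lemma diagonal_closed (G : O -> O -> O) :
  exists H, forall x, closed_pt H x -> forall y, y < x -> closed_pt (G y) x.
Proof.
have HH a : exists b, forall y z, y <= a -> z <= a -> G y z < b.
  have [b Hb] := @countable_bounded _ _ hO
    ((fun p => G p.1 p.2) @` ([set y | y <= a] `*` [set y | y <= a]))
    (sub_countable (card_image_le _ _)
      (countableX (countable_le hO a) (countable_le hO a))).
  by exists b => y z ya za; apply: Hb; exists (y, z).
have /choice[H HHH] := HH; exists H => x [ne Hx] y yx; split=> // z zx.
have [yz|zy] := leP y z.
  by apply: lt_trans (Hx z zx); apply: HHH.
by apply: lt_trans (Hx y yx); apply: HHH => //; exact: ltW.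
Qed.

(** Otherwise each fibre of f misses the closed points of some function; a
    point of S closed for the diagonal of these functions misses its own fibre. *)
Lemma fodor (S : set O) (f : O -> O) : stationary S -> (forall x, S x -> f x < x) ->
  exists y, stationary (S `&` [set x | f x = y]).
Proof.
move=> sS fS; apply: contrapT => H.
have /choice[G HG] : forall y, exists F, forall x, S x -> f x = y -> ~ closed_pt F x.
  move=> y; apply: contrapT => Hy; apply: H; exists y => F.
  apply: contrapT => HF; apply: Hy; exists F => x Sx fx clx; apply: HF; by exists x.
have [K HK] := diagonal_closed G.
have [x Sx clx] := sS K.
by apply: (HG (f x) x) => //; apply: HK => //; exact: fS.
Qed.

Lemma stat_pigeonhole T (A : set T) (S : set O) (f : O -> T) : countable A ->
  stationary S -> (forall x, S x -> A (f x)) ->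
  exists2 y, A y & stationary (S `&` [set x | f x = y]).
Proof.
move=> cA sS fS; apply: contrapT => H.
have /choice_on/(_ id)[F HF] : forall y, A y ->
    exists F, forall x, S x -> f x = y -> ~ closed_pt F x.
  move=> y Ay; apply: contrapT => Hy; apply: H; exists y => // F.
  apply: contrapT => HF; apply: Hy; exists F => x Sx fx clx; apply: HF; by exists x.
have /choice[K HK] : forall a, exists b, forall y, A y -> F y a < b.
  move=> a; have [b Hb] := @countable_bounded _ _ hO ((fun y => F y a) @` A)
    (sub_countable (card_image_le _ _) cA).
  by exists b => y Ay; apply: Hb; exists y.
have [x Sx [ne clx]] := sS K.
apply: (HF (f x) (fS _ Sx) x Sx erefl); split=> // y yx.
by apply: lt_trans (clx _ yx); apply: HK; exact: fS.
Qed.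

Lemma stat_pigeonhole_count (T : countType) (S : set O) (f : O -> T) :
  stationary S -> exists y, stationary (S `&` [set x | f x = y]).
Proof.
by move=> sS; have [//|y _] := @stat_pigeonhole T setT S f (countableP _) sS; exists y.
Qed.

Lemma stat_split (S B : set O) : stationary S -> ~ stationary (S `&` B) -> stationary (S `\` B).
Proof.
move=> sS nB; have [[] sB] := @stat_pigeonhole_count bool S (fun x => `[< B x >]) sS.
  by case: nB; apply: stat_sub sB => x [Sx /= /asboolP].
by apply: stat_sub sB => x [Sx /= /asboolP].
Qed.

Lemma uncountable_stat_next (A : set O) : ~ countable A ->
  exists f : O -> O, forall x, A (f x) /\ x <= f x.
Proof.
move=> ncA; have /choice[f Hf] : forall x, exists y, A y /\ x <= y.
  by move=> x; have [y Ay /ltW] := uncountable_unbounded hO ncA x; exists y.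
by exists f.
Qed.

End Closed.

(** * Partitions into stationary sets *)

Lemma increasing_nat d (T : orderType d) (f : nat -> T) :
  (forall n, (f n < f n.+1)%O) -> forall m n, (m < n)%N -> (f m < f n)%O.
Proof.
move=> Hf m n; elim: n => // n IH; rewrite ltnS leq_eqVlt => /orP[/eqP->//|/IH H].
exact: lt_trans H (Hf n).
Qed.

Lemma increasing_nat_inj d (T : orderType d) (f : nat -> T) :
  (forall n, (f n < f n.+1)%O) -> injective f.
Proof.
move=> /increasing_nat H m n E; case: (ltngtP m n) => // /H; by rewrite E ltxx.
Qed.

Section Ulam.
Context {d : Order.disp_t} {O : orderType d} (hO : omega1_like O).
Local Open Scope order_scope.
Local Open Scope classical_set_scope.

Lemma initial_codes : exists e : O -> O -> nat,
  forall b x y, x <= b -> y <= b -> e b x = e b y -> x = y.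
Proof.
have /choice[e He] : forall b : O, exists f : O -> nat, forall x y, x <= b -> y <= b -> f x = f y -> x = y.
  move=> b; have /countable_injP[f Hf] := countable_le hO b.
  by exists f => x y xb yb; apply: Hf; rewrite inE.
by exists e.
Qed.

Lemma nonstationary (S : set O) : ~ stationary S -> exists F, forall x, S x -> ~ closed_pt F x.
Proof.
move=> nS; apply: contrapT => H; apply: nS => F; apply: contrapT => HF; apply: H.
by exists F => x Sx cx; apply: HF; exists x.
Qed.

(** Ulam's argument.  Code each initial segment by natural numbers.  For some
    y the codes of y give infinitely many stationary sets; if not, uncountably
    many y would have almost all their codes below one number m, and some x
    would code more than m of them by numbers below m.  Renumbering these
    infinitely many sets gives the partition. *)
Lemma ulam_partition : exists P : O -> nat, forall i, stationary [set x | P x = i].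
Proof.
have [e He] := initial_codes.
have [y Hy] : exists y, forall N : nat, exists2 n, (N <= n)%N & stationary [set x | y < x /\ e x y = n].
  apply: contrapT => H.
  have /choice[N HN] : forall y, exists N : nat, forall n, (N <= n)%N ->
      ~ stationary [set x | y < x /\ e x y = n].
    move=> y; apply: contrapT => Hy; apply: H; exists y => N; apply: contrapT => HN.
    by apply: Hy; exists N => n Nn sn; apply: HN; exists n.
  have [m sm] := stat_pigeonhole_count hO N (statT hO).
  have ncZ := stat_uncountable hO sm.
  have /choice[G HG] : forall y, exists F, N y = m -> forall x, y < x -> closed_pt F x -> (e x y < m)%N.
    move=> y; have [Ny|] := eqVneq (N y) m; last by move=> /eqP nn; exists id => /nn.
    have [|F HF] := @nonstationary [set x | y < x /\ (m <= e x y)%N].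
      move=> st; have [n sn] := stat_pigeonhole_count hO (fun x => e x y) st.
      have [x0 [[_ mn] en] _] := sn id.
      apply: (HN y n); first by rewrite Ny -en.
      by apply: stat_sub sn => x [[yx _] ex].
    exists F => _ x yx cx; rewrite ltnNge; apply/negP => mx.
    exact: (HF x).
  have [K HK] := diagonal_closed hO G.
  have /choice[f Hf] : forall x, exists z, N z = m /\ x < z.
    by move=> x; have [z [_ Nz] xz] := uncountable_unbounded hO ncZ x; exists z.
  have [o _] := omega1_pt hO.
  pose z n := iter n.+1 f o.
  (* x is beyond all z n, whose codes in x are distinct and below m *)
  have [b Hb] := countable_bounded hO (sub_countable (card_image_le z setT) (countableP _)).
  have [x _ [cx bx]] := stat_unbounded K b (statT hO).
  have zx n : z n < x by apply: lt_trans bx; apply: Hb; exists n.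
  have zm n : (e x (z n) < m)%N.
    by apply: (HG (z n)) => //; [have [] := Hf (iter n f o)|exact: HK].
  suff: (m.+1 <= m)%N by rewrite ltnn.
  apply: (@pigeonhole _ _ (fun n => e x (z n))); last by move=> _ [n _ <-] /=.
  move=> i j _ _ E; apply: (@increasing_nat_inj _ _ z) => [n|].
    by have [] := Hf (z n).
  by apply: (He x) => //; apply/ltW.
have /choice[g Hg] : forall N : nat, exists n : nat, (N <= n)%N /\ stationary [set x | y < x /\ e x y = n].
  by move=> N; have [n] := Hy N; exists n.
pose s n := iter n (fun k => g k.+1) (g 0%N).
have s_inj : injective s.
  by apply: (@increasing_nat_inj _ nat) => n /=; rewrite ltEnat /=; have [] := Hg (s n).+1.
have Ss n : stationary [set x | y < x /\ e x y = s n].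
  by case: n => [|n]; [exact: (Hg 0%N).2 | exact: (Hg (s n).+1).2].
exists (fun x => xget 0%N [set i | s i = e x y]) => i.
apply: stat_sub (Ss i) => x [_ ex] /=.
case: xgetP => [j _ /= |/(_ i)]; last by rewrite /= ex.
by rewrite ex => /s_inj.
Qed.

(** The colour of A, B and n is the class, in a stationary partition, of the
    least ordinal in [A, B] whose number in the enumeration of B is at most n.
    If x <= B and n is at least the number of x, only finitely many ordinals
    compete with x, and those below x are avoided once A is close enough to x:
    the least ordinal is then x itself. *)
Lemma marker_colouring : exists mu : O -> O -> nat -> nat, forall i,
  stationary [set x | forall B, x <= B -> exists N, forall n, (N <= n)%N ->
     exists2 z, z < x & forall A, z <= A -> A < x -> mu A B n = i].
Proof.
have [e He] := initial_codes; have [P HP] := ulam_partition.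
have [o _] := omega1_pt hO.
pose first A B n := xget o [set x | [/\ A <= x, x <= B, (e B x <= n)%N &
  forall y, A <= y -> y <= B -> (e B y <= n)%N -> x <= y]].
exists (fun A B n => P (first A B n)) => i.
have /choice[nx Hnx] := omega1_gt hO.
apply: stat_sub (statI_closed nx (HP i)) => x [Pxi [[x0 x0x] cx]] B xB.
exists (e B x) => n en.
have [z zx Hz] : exists2 z, z < x & forall y, y < x -> (e B y <= n)%N -> y < z.
  elim: n {en} => [|n [z zx IH]].
    have [[y [yx ey]]|H] := pselect (exists y, y < x /\ e B y = 0%N).
      exists (nx y); first exact: cx.
      move=> y' y'x; rewrite leqn0 => /eqP e0.
      suff -> : y' = y by exact: Hnx.
      by apply: (He B); rewrite ?ey ?e0 //; apply: le_trans xB; apply: ltW.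
    exists x0 => // y yx; rewrite leqn0 => /eqP ey; case: H; by exists y.
  have [[y [yx ey]]|H] := pselect (exists y, y < x /\ e B y = n.+1).
    exists (Order.max z (nx y)); first by rewrite gt_max zx cx.
    move=> y' y'x; rewrite leq_eqVlt ltnS => /orP[/eqP e0|/IH]; rewrite lt_max; last by move=> ->.
    suff -> : y' = y by rewrite Hnx orbT.
    by apply: (He B); rewrite ?ey ?e0 //; apply: le_trans xB; apply: ltW.
  exists z => // y yx; rewrite leq_eqVlt ltnS => /orP[/eqP ey|]; last exact: IH.
  by case: H; exists y.
exists z => // A zA Ax.
suff -> : first A B n = x by [].
rewrite /first; case: xgetP => [y _ [Ay yB ey ymin]|].
  have := ymin x (ltW Ax) xB en; rewrite le_eqVlt => /orP[/eqP//|yx].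
  by have := Hz y yx ey; rewrite ltNge (le_trans zA Ay).
move=> /(_ x); case; split=> // [|y Ay yB ey]; first exact: ltW.
rewrite leNgt; apply/negP => yx; have := Hz y yx ey; by rewrite ltNge (le_trans zA Ay).
Qed.

End Ulam.

(** * A subadditive function on omega_2 *)

Definition least d (T : orderType d) (A : set T) : set T :=
  [set x | A x /\ forall y, A y -> (x <= y)%O].

Lemma wf_fix d (W : orderType d) (wfW : wf_order W) (T : Type)
    (B : forall x : W, (forall y, (y < x)%O -> T) -> T) :
  exists f : W -> T, forall x, f x = B x (fun y _ => f y).
Proof.
exists (Fix wfW (fun _ => T) B) => x; rewrite Fix_eq // => {}x f g fg.
congr B; apply: functional_extensionality_dep => y.
by apply: functional_extensionality_dep => yx; exact: fg.
Qed.

(** The order type of W is at most omega_2. *)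
Definition omega2_like d d' (O : orderType d) (W : orderType d') : Prop :=
  wf_order W /\ forall c : W, exists i : W -> O,
     forall x y, (x < c)%O -> (y < c)%O -> i x = i y -> x = y.

Section Rho.
Context {d d' : Order.disp_t} {O : orderType d} {W : orderType d'}.
Context (hO : omega1_like O) (hW : omega2_like O W).
Local Open Scope order_scope.
Local Open Scope classical_set_scope.

Let wfO : wf_order O := let: And3 h _ _ := hO in h.

(** The last two clauses say that rho a c <= max (rho a b) (rho b c) and
    rho a b <= max (rho a c) (rho b c).  Hence for each v the relation
    (w < x and rho w x <= v) is a tree order, with countably many predecessors
    by the first clause. *)
Definition subadditive (rho : W -> W -> O) : Prop :=
  [/\ forall x v, countable [set w | w < x /\ rho w x <= v],
      forall v a b c, a < b -> b < c -> rho a b <= v -> rho b c <= v -> rho a c <= v &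
      forall v a b c, a < b -> b < c -> rho a c <= v -> rho b c <= v -> rho a b <= v].

Lemma leastP (A : set O) (o : O) : A !=set0 -> least A (xget o (least A)).
Proof.
move=> ne; case: xgetP => // /(_ _) H.
have [x Ax xm] := wf_min wfO ne; by case: (H x).
Qed.

(** By recursion on c.  Let i number the ordinals below c by elements of O, and
    let N j >= j bound rho on the countably many pairs with numbers at most j.
    Then the ordinals x < c with N (i x) <= v form a chain of the tree order of
    radius v, and the predecessors of c for that radius are these x and their
    own predecessors. *)
Lemma subadditive_exists : exists rho, subadditive rho.
Proof.
have [o _] := omega1_pt hO; have [wfW /choice[i Hi]] := hW.
pose NS (c : W) (r : W -> W -> O) (j : O) : set O := [set b | j <= b /\
  forall x y, x < c -> y < c -> x < y -> i c x <= j -> i c y <= j -> r y x <= b].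
pose SS (c : W) (r : W -> W -> O) (w : W) : set O := [set v | exists x,
  [/\ w <= x, x < c, xget o (NS c r (i c x)) <= v & w = x \/ r x w <= v]].
pose ext (c : W) (r : forall y, y < c -> W -> O) (y : W) : W -> O :=
  if pselect (y < c) is left h then r y h else fun=> o.
have [r Hr] := @wf_fix _ _ wfW (W -> O) (fun c rr => let r := ext c rr in
  fun w => xget o (least (SS c r w))).
have extE c : forall y, y < c -> ext c (fun y _ => r y) y = r y.
  by rewrite /ext => y yc; case: pselect.
have NSE c j : NS c (ext c (fun y _ => r y)) j = NS c r j.
  apply/seteqP; split => b [jb H]; split => // x y xc yc xy ix iy.
    by rewrite -(extE c) // H.
  by rewrite (extE c) // H.
have SSE c w : SS c (ext c (fun y _ => r y)) w = SS c r w.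
  apply/seteqP; split => v [x [wx xc Nv H]]; exists x; rewrite NSE in Nv *; split=> //.
    by rewrite (extE c) in H.
  by rewrite (extE c).
have NSP c j : NS c r j (xget o (NS c r j)).
  case: xgetP => // ne.
  have cI : countable [set x | x < c /\ i c x <= j].
    apply: (@inj_countable _ _ (i c) _ [set y | y <= j] (countable_le hO j)).
      by move=> x [].
    by move=> x y [? _] [? _]; exact: Hi.
  have [b Hb] := countable_bounded hO
    (sub_countable (card_image_le (fun p => r p.2 p.1) _) (countableX cI cI)).
  case: (ne (Order.max b j)); split; first by rewrite le_max lexx orbT.
  by move=> x y xc yc xy ix iy; rewrite le_max ltW // Hb //; exists (x, y).
pose N c j := xget o (NS c r j).
have Nj c j : j <= N c j by case: (NSP c j).
have NP c x y : x < c -> y < c -> x < y -> r y x <= N c (Order.max (i c x) (i c y)).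
  by move=> xc yc xy; case: (NSP c (Order.max (i c x) (i c y))) => _; apply; rewrite // le_max lexx ?orbT.
have rP c w v : w < c -> r c w <= v <-> SS c r w v.
  move=> wc; have -> : r c w = xget o (least (SS c r w)) by rewrite Hr /= SSE.
  have [|[x [wx xc Nv H]] mn] := @leastP (SS c r w) o; last first.
    split=> [lev|/mn //]; exists x; split=> //; first exact: le_trans lev.
    by case: H => [->|H]; [left|right; exact: le_trans lev].
  by exists (N c (i c w)); exists w; split=> //; left.
pose R v w x := w = x \/ w < x /\ r x w <= v.
have RS c w v : w < c -> r c w <= v <-> exists x, [/\ R v w x, x < c & N c (i c x) <= v].
  move=> wc; rewrite rP //; split.
    move=> [x [wx xc Nv H]]; exists x; split=> //; move: wx; rewrite le_eqVlt /R.
    by case/orP=> [/eqP|wx]; [left|case: H => [|h]; [left|right]].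
  move=> [x [[->|[wx H]] xc Nv]]; exists x; split=> //; first by left.
    exact: ltW.
  by right.
exists (fun w x => r x w); split.
- move=> x v; elim: (wfW x) => {}x _ IH.
  apply: (@sub_countable _ _ _ (\bigcup_(y in [set y | y < x /\ i x y <= v])
     ([set y] `|` [set w | w < y /\ r y w <= v]))).
    apply: subset_card_le => w [wx /RS] [//|y [Rwy yx Nv]]; exists y => /=.
      by split=> //; exact: le_trans (Nj _ _) Nv.
    exact: Rwy.
  apply: bigcup_countable => [|y [yx _]].
    apply: (@inj_countable _ _ (i x) _ [set y | y <= v] (countable_le hO v)).
      by move=> y [].
    by move=> y z [? _] [? _]; exact: Hi.
  apply: (@sub_countable _ _ _ (\bigcup_b (if b then [set y] else [set w | w < y /\ r y w <= v]))).
    by apply: subset_card_le => z [?|?]; [exists true|exists false].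
  by apply: bigcup_countable => // -[] _; [exact: countable1|exact: IH].
- move=> v a b c; elim: (wfW c) a b => {}c _ IH a b ab bc Rab.
  move=> /RS [//|x [Rbx xc Nv]]; apply/RS; first exact: lt_trans bc.
  exists x; split=> //; right; case: Rbx => [<-//|[bx Rbx]]; split; first exact: lt_trans bx.
  exact: (IH x xc a b).
- move=> v a b c; elim: (wfW c) a b => {}c _ IH a b ab bc.
  have tr x y z : z < c -> R v x y -> R v y z -> R v x z.
    move=> zc [->//|[xy Rxy]] [<-|[yz Ryz]]; first by right.
    right; split; first exact: lt_trans yz.
    have yc : y < c by exact: lt_trans zc.
    move: Rxy Ryz zc; move: xy yz; clear -RS wfW.
    elim: (wfW z) x y => {}z _ IH x y xy yz Rxy /RS [//|t [Ryt tz Nv]] zc.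
    apply/RS; first exact: lt_trans yz.
    exists t; split=> //; right; case: Ryt => [<-//|[yt Ryt]]; split; first exact: lt_trans yt.
    by apply: (IH t tz x y) => //; exact: lt_trans zc.
  have fin x y z : z < c -> x < y -> R v x z -> R v y z -> r y x <= v.
    move=> zc xy Rxz [yz|[yz Ryz]]; first by subst y; case: Rxz => [xz|[]//]; rewrite xz ltxx in xy.
    case: Rxz => [xz|[xz Rxz]]; first by have := lt_trans xy yz; rewrite xz ltxx.
    exact: (IH z zc x y).
  move=> /RS [|x [Rax xc Nx]]; first exact: lt_trans bc.
  move=> /RS [//|y [Rby yc Ny]].
  have [xy|yx|xy] := ltgtP x y.
  + apply: (fin a b y) => //; apply: (tr a x) => //; right; split => //.
    by apply: le_trans (NP c x y xc yc xy) _; rewrite /Order.max; case: ifP.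
  + apply: (fin a b x) => //; apply: (tr b y) => //; right; split => //.
    by apply: le_trans (NP c y x yc xc yx) _; rewrite /Order.max; case: ifP.
  + by apply: (fin a b x) => //; rewrite xy.
Qed.

(** p v is the rank function of the tree order of radius v, started at v in
    order to dominate the radius. *)
Lemma rank_exists rho : subadditive rho -> exists p : O -> W -> O,
  [/\ forall v x, v <= p v x,
      forall v w x, w < x -> rho w x <= v -> p v w < p v x &
      forall v v' x, v <= v' -> p v x <= p v' x].
Proof.
move=> [crho _ _]; have [o _] := omega1_pt hO; have [wfW _] := hW.
pose A v x (rec : W -> O) := [set b | v <= b /\ forall w, w < x -> rho w x <= v -> rec w < b].
pose ext (c : W) (r : forall y, y < c -> O) (y : W) : O :=
  if pselect (y < c) is left h then r y h else o.
have /choice[p Hp] : forall v, exists f : W -> O, forall x, f x = xget o (least (A v x f)).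
  move=> v; have [f Hf] := @wf_fix _ _ wfW O (fun x r => xget o (least (A v x (ext x r)))).
  exists f => x; rewrite Hf; congr (xget o (least _)).
  have extE c y : y < c -> ext c (fun y _ => f y) y = f y.
    by rewrite /ext => yc; case: pselect.
  by apply/seteqP; split => b [vb H]; split => // w wx rw; have := H w wx rw; rewrite extE.
have {Hp} Hp v x : least (A v x (p v)) (p v x).
  rewrite Hp; apply: leastP.
  have [b Hb] := countable_bounded hO (sub_countable (card_image_le (p v) _) (crho x v)).
  exists (Order.max b v); split; first by rewrite le_max lexx orbT.
  by move=> w wx rw; rewrite lt_max Hb //; exists w.
exists p; split.
- by move=> v x; have [[]] := Hp v x.
- by move=> v w x wx rw; have [[_ H] _] := Hp v x; exact: H.
- move=> v v' x vv'; elim: (wfW x) => {}x _ IH.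
  have [_ mn] := Hp v x; apply: mn; have [[v'p H] _] := Hp v' x.
  split; first exact: le_trans v'p.
  move=> w wx rw; apply: le_lt_trans (IH w wx) _; apply: H => //; exact: le_trans vv'.
Qed.

End Rho.

(** * Traces and their oscillation *)

(** Every interval of 2 ^ (i + 1) integers contains an odd multiple of 2 ^ i. *)
Lemma logn_interval c i : exists2 r, (r < 2 ^ i.+1)%N & logn 2 (c + r).+1 = i.
Proof.
pose D := (2 ^ i.+1)%N; have D2 : (D = 2 * 2 ^ i)%N by rewrite /D expnS.
have P0 : (0 < 2 ^ i)%N by rewrite expn_gt0.
have lg k : logn 2 (k * D + 2 ^ i) = i.
  have -> : (k * D + 2 ^ i = (k * 2).+1 * 2 ^ i)%N by rewrite D2 mulnA -mulSnr.
  rewrite lognM // pfactorK // lognE /= dvdn2 /=.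
  by rewrite oddM andbF.
rewrite -/D; have Dc := divn_eq c D; have cD : (c %% D < D)%N by rewrite ltn_mod D2; lia.
have [le|gt] := leqP (c %/ D * D + 2 ^ i) c.
  exists ((c %/ D).+1 * D + 2 ^ i - c.+1)%N; first by rewrite mulSn; lia.
  by rewrite -[RHS](lg (c %/ D).+1); congr logn; rewrite mulSn; lia.
exists (c %/ D * D + 2 ^ i - c.+1)%N; first by lia.
by rewrite -[RHS](lg (c %/ D)); congr logn; lia.
Qed.

Section Trace.
Context {d d' : Order.disp_t} {O : orderType d} {W : orderType d'}.
Context (wfO : wf_order O) (wfW : wf_order W).
Context (rho : W -> W -> O) (hrho : subadditive rho).
Local Open Scope order_scope.
Local Open Scope classical_set_scope.

(** The left-to-right minima of rho( . , x) on [a, x], where x itself counts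
    as a minimum. *)
Definition trace (a x : W) : set W :=
  [set w | [/\ a <= w, w <= x &
     w < x -> forall y, a <= y -> y < w -> rho w x < rho y x]].

Lemma trace_end a x : a <= x -> trace a x x.
Proof. by move=> ax; split=> //; rewrite ltxx. Qed.

Lemma trace_start a x : a <= x -> trace a x a.
Proof. by move=> ax; split=> // _ y ay; rewrite ltNge ay. Qed.

(** Along the trace the values of rho( . , x) decrease. *)
Lemma trace_finite a x : finite_set (trace a x).
Proof.
have fin w : trace a x w -> finite_set (trace a x `&` [set y | w <= y]).
  have [n] : exists n, n = rho w x by exists (rho w x).
  elim: (wfO n) w => {}n _ IH w nE tw; have [aw wx H] := tw.
  move: wx; rewrite le_eqVlt => /orP[/eqP wx|wx].
    apply: (@sub_finite_set _ _ [set x]); last exact: finite_set1.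
    by move=> y [[_ yx _]] /= wy; apply/eqP; rewrite eq_le yx -wx.
  have [|w1 [tw1 ww1] mw1] := @wf_min _ _ [set y | trace a x y /\ w < y] wfW.
    by exists x; split=> //; apply: trace_end; exact: le_trans (ltW wx).
  apply: (@sub_finite_set _ _ ([set w] `|` (trace a x `&` [set y | w1 <= y]))).
    move=> y [ty /=]; rewrite le_eqVlt => /orP[/eqP|wy]; first by left.
    by right; split=> //; apply: mw1.
  rewrite finite_setU; split; first exact: finite_set1.
  have [aw1 w1x H1] := tw1; move: (w1x); rewrite le_eqVlt => /orP[/eqP E|w1x'].
    apply: (@sub_finite_set _ _ [set x]); last exact: finite_set1.
    by move=> y [[_ yx _]] /= wy; apply/eqP; rewrite eq_le yx -E.
  by apply: (IH (rho w1 x)) => //; rewrite nE; exact: H1.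
have [ax|xa] := leP a x.
  apply: sub_finite_set (fin a (trace_start ax)) => w tw; split=> //.
  by case: tw.
apply: (@sub_finite_set _ _ set0); last exact: finite_set0.
by move=> w [aw wx _]; have := le_trans aw wx; rewrite leNgt xa.
Qed.

(** For y < p the trace condition gives rho p x < rho y x, so the two
    ultrametric inequalities force rho y p = rho y x. *)
Lemma trace_cut a p x w : trace a x p -> trace a p w <-> trace a x w /\ w <= p.
Proof.
move=> [ap px Hp]; have [_ up down] := hrho.
move: px; rewrite le_eqVlt => /orP[/eqP px|px].
  by subst x; split=> [tw|[]//]; split=> //; case: tw.
have eqr y : a <= y -> y < p -> rho y p = rho y x.
  move=> ay yp; have lt := Hp px y ay yp; apply/eqP; rewrite eq_le; apply/andP; split.
    by apply: (down _ y p x) => //; exact: ltW.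
  rewrite leNgt; apply/negP => h.
  have : rho y x <= Order.max (rho y p) (rho p x).
    by apply: (up _ y p x yp px); rewrite le_max lexx ?orbT.
  by rewrite leNgt gt_max h lt.
split.
  move=> [aw wp H]; split=> //; split=> //; first exact: le_trans (ltW px).
  move: wp; rewrite le_eqVlt => /orP[/eqP -> _|wp _] y ay yw; first exact: Hp.
  by rewrite -!eqr //; [exact: H|exact: lt_trans wp].
move=> [[aw wx H] wp]; split=> // wp' y ay yw.
by rewrite !eqr //; [apply: H => //; exact: lt_trans px|exact: lt_trans wp'].
Qed.

(** The first elements of the runs of B that follow an element of A, when A
    and B are listed together in increasing order. *)
Definition switches (A B : set W) : set W :=
  [set b | B b /\ exists a, [/\ A a, a < b & forall b', B b' -> b' < b -> b' < a]].

Definition osc (a g t : W) : nat := #|` fset_set (switches (trace a g) (trace a t)) |%fset.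

Lemma switches_finite A a t : finite_set (switches A (trace a t)).
Proof. by apply: sub_finite_set (trace_finite a t) => b []. Qed.

Variable a : W.

(** p' prolongs p: the trace of p' adds to that of p only points of (p, z] and
    points beyond m.  The bound z depends on p alone, while m is at the choice
    of the player. *)
Definition link (m p z p' : W) : Prop :=
  [/\ p < p', m < p', trace a p' p & forall w, trace a p' w -> p < w -> w <= z \/ m < w].

(** A position of the game, in which the points p and q are prolonged in turn
    and p was moved last.  The interval [q, z] is reserved for the points that
    the next prolongation of q may add near q. *)
Definition p_top (p q z : W) : Prop :=
  [/\ q < p, z < p & forall w, trace a p w -> w < q \/ z < w].

Lemma link_split m p z p' w : link m p z p' -> trace a p' w ->
  trace a p w /\ w <= p \/ p < w /\ (w <= z \/ m < w).
Proof.
move=> [pp' mp' tp H] tw; have [wp|pw] := leP w p; last by right; split=> //; exact: H.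
by left; split=> //; apply/(trace_cut _ tp).
Qed.

Lemma link_sub m p z p' w : link m p z p' -> trace a p w -> trace a p' w /\ w <= p.
Proof. by move=> [_ _ tp _] /(trace_cut _ tp). Qed.

(** Exactly one switch is new: the least point of the trace of q' beyond m.
    The points added near q bring none, since no point of the trace of p lies
    between q and z. *)
Lemma q_move_switch p q zq m q' zp : a <= p -> p_top p q zq -> p <= m -> zp <= m ->
  link m q zq q' -> p_top q' p zp /\ osc a p q' = (osc a p q).+1.
Proof.
move=> ap [qp zqp free] pm zpm lk; have [qq' mq' tq Hq] := lk.
have pq' : p < q' by exact: le_lt_trans mq'.
split.
  split=> //; first exact: le_lt_trans mq'.
  move=> w /(link_split lk)[[tw wq]|[qw [wz|mw]]].
  - by left; exact: le_lt_trans qp.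
  - by left; exact: le_lt_trans zqp.
  - by right; exact: le_lt_trans mw.
have [|b [tb mb] bmin] := @wf_min _ _ [set b | trace a q' b /\ m < b] wfW.
  by exists q'; split=> //; apply: trace_end; apply: le_trans (ltW pq').
have tle w x : trace a x w -> w <= x by case.
have qb : q < b by apply: lt_trans qp _; exact: le_lt_trans mb.
have E : switches (trace a p) (trace a q') = b |` switches (trace a p) (trace a q).
  apply/seteqP; split => [b1 [tb1 [w [tw wb1 H]]]|b1 [->|[tb1 [w [tw wb1 H]]]]].
  - have [[tb1' b1q]|[qb1 [b1z|mb1]]] := link_split lk tb1.
    + by right; split=> //; exists w; split=> // b' /(link_sub lk)[tb' _]; exact: H.
    + have qw := H q tq qb1; have [|zw] := free w tw; first by rewrite ltNge ltW.
      by have := lt_le_trans wb1 b1z; rewrite ltNge ltW.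
    + left; apply/eqP; rewrite eq_le bmin // andbT leNgt; apply/negP => bb1.
      have := H b tb bb1; rewrite ltNge (ltW (le_lt_trans _ mb)) //.
      by apply: le_trans (tle _ _ tw) pm.
  - split=> //; exists p; split; [exact: trace_end|exact: le_lt_trans mb|].
    move=> b' tb' b'b; have [[_ b'q]|[_ [b'z|mb']]] := link_split lk tb'.
    + exact: le_lt_trans qp.
    + exact: le_lt_trans zqp.
    + by have := bmin b' (conj tb' mb'); rewrite leNgt b'b.
  - have [tb1' b1q] := link_sub lk tb1; split=> //; exists w; split=> // b' tb' b'b1.
    apply: H => //; have [[]//|[qb' _]] := link_split lk tb'.
    by have := lt_trans qb' b'b1; rewrite ltNge b1q.
rewrite /osc E fset_setU1; last exact: switches_finite.
rewrite cardfsU1 in_fset_set; last exact: switches_finite.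
case: (boolP (b \in _)) => // /set_mem [/tle bq _].
by rewrite leNgt qb in bq.
Qed.

Lemma p_move_same p q zq m zp p' : p_top p q zq ->
  link m p zp p' -> p_top p' q zq /\ osc a p' q = osc a p q.
Proof.
move=> [qp zqp free] lk; have [pp' mp' tp Hp] := lk.
split.
  split; [exact: lt_trans pp'|exact: lt_trans pp'|].
  move=> w /(link_split lk)[[tw wq]|[pw _]]; first exact: free.
  by right; exact: lt_trans pw.
rewrite /osc; congr #|` fset_set _ |%fset; apply/seteqP; split => b [tb [w [tw wb H]]];
  split=> //; exists w; split=> //; last by have [] := link_sub lk tw.
have [[]//|[pw _]] := link_split lk tw.
have [_ bq _] := tb; have := lt_le_trans (lt_trans pw wb) bq.
by rewrite ltNge (ltW qp).
Qed.

Lemma p_move_over p q zq m zp p' : p < q -> zp < q -> q <= m -> zq <= m ->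
  link m p zp p' -> p_top p' q zq.
Proof.
move=> pq zpq qm zqm lk; have [pp' mp' tp Hp] := lk.
split; [exact: le_lt_trans mp'|exact: le_lt_trans mp'|].
move=> w /(link_split lk)[[tw wp]|[pw [wz|mw]]].
- by left; exact: le_lt_trans pq.
- by left; exact: le_lt_trans zpq.
- by right; exact: le_lt_trans mw.
Qed.

(** The trace of p gains points in (p, z], but these lie in the gap of the
    trace of q that follows p, where a switch is already counted. *)
Lemma p_move_back p q zq m zp p' : a <= p -> p_top q p zp -> q <= m -> zq <= m ->
  link m p zp p' -> p_top p' q zq /\ osc a p' q = osc a p q.
Proof.
move=> ap [pq zpq free] qm zqm lk; split; first exact: p_move_over lk.
have [pp' mp' tp Hp] := lk.
rewrite /osc; congr #|` fset_set _ |%fset; apply/seteqP; split => b [tb [w [tw wb H]]];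
  split=> //; last by exists w; split=> //; have [] := link_sub lk tw.
have [[tw' _]|[pw [wz|mw]]] := link_split lk tw; first by exists w.
  exists p; split; [exact: trace_end|exact: lt_trans wb|].
  move=> b' tb' b'b; have [//|zb'] := free b' tb'.
  by have := lt_le_trans (H _ tb' b'b) wz; rewrite ltNge (ltW zb').
have [_ bq _] := tb; have := lt_le_trans (lt_trans mw wb) bq.
by rewrite ltNge qm.
Qed.

Lemma q_move_same p q zq m zp q' : p_top q p zp ->
  link m q zq q' -> p_top q' p zp /\ osc a p q' = osc a p q.
Proof.
move=> [pq zpq free] lk; have [qq' mq' tq Hq] := lk.
split.
  split; [exact: lt_trans qq'|exact: lt_trans qq'|].
  move=> w /(link_split lk)[[tw wq]|[qw _]]; first exact: free.
  by right; exact: lt_trans qw.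
rewrite /osc; congr #|` fset_set _ |%fset; apply/seteqP; split => b [tb [w [tw wb H]]].
  have [[tb' _]|[qb _]] := link_split lk tb.
    by split=> //; exists w; split=> // b' /(link_sub lk)[tb'' _]; exact: H.
  have qw := H q tq qb; have [_ wp _] := tw; have := lt_le_trans qw wp.
  by rewrite ltNge (ltW pq).
have [tb' bq] := link_sub lk tb; split=> //; exists w; split=> // b' tb'' b'b.
apply: H => //; have [[]//|[qb' _]] := link_split lk tb''.
by have := lt_trans qb' b'b; rewrite ltNge bq.
Qed.

Variable dominated : set W.
Hypothesis dominated_max : forall x y, dominated x -> dominated y -> dominated (Order.max x y).

(** p can be prolonged n times, ending in P, each time beyond any prescribed
    dominated bound. *)
Fixpoint extendable (P : set W) (n : nat) (z p : W) : Prop :=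
  [/\ dominated z, dominated p & match n with
    | 0 => P p
    | n'.+1 => forall m, dominated m -> exists p' z', link m p z p' /\ extendable P n' z' p'
    end].

Lemma extendable_dominated P n z p : extendable P n z p -> dominated z /\ dominated p.
Proof. by case: n => [|n] /= []. Qed.

Lemma finish_p P n p zp q zq : p_top p q zq -> extendable P n zp p ->
  exists g zg, [/\ p <= g, P g, extendable P 0 zg g, p_top g q zq & osc a g q = osc a p q].
Proof.
elim: n p zp => [|n IH] p zp st; first by move=> ex; exists p, zp; case: (ex).
move=> /= [_ Bp /(_ p Bp)[p' [z' [lk ex]]]]; have [st' oE] := p_move_same st lk.
have [g [zg [p'g Pg eg stg og]]] := IH _ _ st' ex.
exists g, zg; rewrite og oE; split=> //; apply: le_trans p'g.
by case: lk => /ltW.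
Qed.

Lemma finish_q P n p zp q zq : p_top q p zp -> extendable P n zq q ->
  exists t, [/\ P t, p < t & osc a p t = osc a p q].
Proof.
elim: n q zq => [|n IH] q zq st; first by case: (st) => pq _ _ [_ _ Pq]; exists q.
move=> /= [_ Bq /(_ q Bq)[q' [z' [lk ex]]]]; have [st' oE] := q_move_same st lk.
by have [t [Pt pt ot]] := IH _ _ st' ex; exists t; rewrite ot oE.
Qed.

(** Each round moves q and then p, and adds one switch.  The last round takes p
    and then q to their final sets with a single further switch, whatever the
    number of moves left, so that all counts osc a p q + r + 1 are reached from
    one starting position. *)
Lemma play P Q r n n' p zp q zq : a <= p -> p_top p q zq ->
  extendable P (r + n) zp p -> extendable Q (r + n').+1 zq q ->
  exists g t, [/\ p <= g, P g, Q t, g < t & osc a g t = (osc a p q + r).+1].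
Proof.
elim: r p zp q zq => [|r IH] p zp q zq ap st ep eq.
  have [g [zg [pg Pg eg stg og]]] := finish_p st ep.
  have [Bzg Bg] := extendable_dominated eg.
  have [_ Bq /(_ _ (dominated_max Bg Bzg))[q' [zq' [lk eq']]]] := eq.
  have gm : g <= Order.max g zg by rewrite le_max lexx.
  have zm : zg <= Order.max g zg by rewrite le_max lexx orbT.
  have [st' oE] := q_move_switch (le_trans ap pg) stg gm zm lk.
  have [t [Qt gt ot]] := finish_q st' eq'.
  by exists g, t; rewrite ot oE og addn0.
have [Bzp Bp] := extendable_dominated ep.
have [_ Bq /(_ _ (dominated_max Bp Bzp))[q' [zq' [lk eq']]]] := eq.
have pm : p <= Order.max p zp by rewrite le_max lexx.
have zm : zp <= Order.max p zp by rewrite le_max lexx orbT.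
have [st' oE] := q_move_switch ap st pm zm lk.
rewrite -/(extendable Q (r + n').+1 zq' q') in eq'.
have [Bzq' Bq'] := extendable_dominated eq'.
have [_ _ /(_ _ (dominated_max Bq' Bzq'))[p' [zp' [lk' ep']]]] := ep.
rewrite -/(addn r n) in ep'.
have qm : q' <= Order.max q' zq' by rewrite le_max lexx.
have zqm : zq' <= Order.max q' zq' by rewrite le_max lexx orbT.
have [st'' oE'] := p_move_back ap st' qm zqm lk'.
have pp' : p < p' by case: lk'.
have [g [t [p'g Pg Qt gt ot]]] := IH _ _ _ _ (le_trans ap (ltW pp')) st'' ep' eq'.
exists g, t; rewrite ot oE' oE addSnnS; split=> //.
by apply: le_trans p'g; exact: ltW.
Qed.

(** The first move of p makes the starting position independent of the number
    of rounds: the uncontrolled part of the count, near a, is the same for all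
    of them. *)
Lemma all_valuations P Q i p zp q zq : a < p -> p < q -> zp < q ->
  extendable P (2 ^ i.+1).+1 zp p -> extendable Q (2 ^ i.+1).+1 zq q ->
  exists g t, [/\ P g, Q t, a < g, g < t & logn 2 (osc a g t) = i].
Proof.
move=> ap pq zpq ep eq; have [Bzq Bq] := extendable_dominated eq.
have [_ _ /(_ _ (dominated_max Bq Bzq))[p' [zp' [lk ep']]]] := ep.
have qm : q <= Order.max q zq by rewrite le_max lexx.
have zm : zq <= Order.max q zq by rewrite le_max lexx orbT.
have st := p_move_over pq zpq qm zm lk.
have pp' : p < p' by case: lk.
have [r rlt rE] := logn_interval (osc a p' q) i.
have E : (2 ^ i.+1 = r + (2 ^ i.+1 - r))%N by rewrite subnKC // ltnW.
rewrite E in ep' eq.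
have [g [t [p'g Pg Qt gt ot]]] := play (ltW (lt_trans ap pp')) st ep' eq.
exists g, t; rewrite ot rE; split=> //.
by apply: lt_le_trans p'g; exact: lt_trans pp'.
Qed.

End Trace.

(** * Prolonging traces in the confined case *)

Definition rank_for d d' (O : orderType d) (W : orderType d') (rho : W -> W -> O)
    (p : O -> W -> O) : Prop :=
  [/\ forall v x, (v <= p v x)%O,
      forall v w x, (w < x)%O -> (rho w x <= v)%O -> (p v w < p v x)%O &
      forall v v' x, (v <= v')%O -> (p v x <= p v' x)%O].

Section Bounded.
Context {d d' : Order.disp_t} {O : orderType d} {W : orderType d'}.
Context (hO : omega1_like O) (wfW : wf_order W).
Context (rho : W -> W -> O) (hrho : subadditive rho).
Context (p : O -> W -> O) (hp : rank_for rho p).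
Context (u : O -> W) (hu : forall x y, (x < y)%O -> (u x < u y)%O).
Context (nu mu : O).
Local Open Scope order_scope.
Local Open Scope classical_set_scope.
Context (unu : forall x y, x < y -> rho (u x) (u y) < nu).
Context (umu : forall v x, v < nu -> p v (u x) <= mu).

Let wfO : wf_order O := let: And3 h _ _ := hO in h.

Let u_le x y : x <= y -> u x <= u y.
Proof. by rewrite le_eqVlt => /orP[/eqP->//|/hu/ltW]. Qed.

(** w lies below the supremum of the u x with x < e. *)
Definition below (e : O) (w : W) : Prop := exists2 x, x < e & w <= u x.

Lemma nbelow e w : ~ below e w <-> forall x, x < e -> u x < w.
Proof.
split=> [H x xe|H [x xe]]; last by rewrite leNgt H.
by rewrite ltNge; apply/negP => wx; apply: H; exists x.
Qed.

Lemma below_mono e e' w : e <= e' -> below e w -> below e' w.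
Proof. by move=> ee' [x xe wx]; exists x => //; exact: lt_le_trans ee'. Qed.

Lemma below_lt e w w' : below e w -> ~ below e w' -> w < w'.
Proof. by move=> [x xe wx] /nbelow /(_ x xe); exact: le_lt_trans. Qed.

Lemma nbelow_u e : ~ below e (u e).
Proof. by apply/nbelow => x; exact: hu. Qed.

Lemma sub_up v a b c : a < b -> b < c -> rho a b <= v -> rho b c <= v -> rho a c <= v.
Proof. by case: hrho => _ H _; exact: H. Qed.

Lemma sub_down v a b c : a < b -> b < c -> rho a c <= v -> rho b c <= v -> rho a b <= v.
Proof. by case: hrho => _ _; exact. Qed.

Lemma sub_down_lt v a b c : a < b -> b < c -> rho a c < v -> rho b c < v -> rho a b < v.
Proof.
move=> ab bc ac bcv.
apply: (@le_lt_trans _ _ (Order.max (rho a c) (rho b c))); last by rewrite gt_max ac.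
by apply: (sub_down ab bc); rewrite le_max lexx ?orbT.
Qed.

Lemma sub_up_lt v a b c : a < b -> b < c -> rho a b < v -> rho b c < v -> rho a c < v.
Proof.
move=> ab bc ac bcv.
apply: (@le_lt_trans _ _ (Order.max (rho a b) (rho b c))); last by rewrite gt_max ac.
by apply: (sub_up ab bc); rewrite le_max lexx ?orbT.
Qed.

(** The points of the traces from below of points of u.  They share the bounds
    nu and mu with u. *)
Definition hull : set W := [set x | exists z, x = u z \/ x < u z /\ rho x (u z) < nu].

Lemma hull_rho x z : hull x -> u z < x -> rho (u z) x < nu.
Proof.
move=> [t [->|[xt rx]]] zx.
  by apply: unu; rewrite ltNge; apply/negP => /u_le; rewrite leNgt zx.
apply: (sub_down_lt zx xt) => //; apply: unu.
rewrite ltNge; apply/negP => /u_le; rewrite leNgt.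
by rewrite (lt_trans zx xt).
Qed.

Lemma hull_rank x v : hull x -> v < nu -> p v x <= mu.
Proof.
case: hp => _ up mono [t [->|[xt rx]]] vnu; first exact: umu.
have lt : Order.max v (rho x (u t)) < nu by rewrite gt_max vnu.
apply: le_trans (umu t lt); apply: le_trans (mono v _ x _) (ltW (up _ x _ xt _)).
  by rewrite le_max lexx.
by rewrite le_max lexx orbT.
Qed.

Lemma hull_down x y : hull x -> y < x -> rho y x < nu -> hull y.
Proof.
move=> [t [->|[xt rx]]] yx ry; exists t; right; first by split.
by split; [exact: lt_trans xt|exact: (sub_up_lt yx xt)].
Qed.

Lemma hull_bounded x : hull x -> exists z, x <= u z.
Proof. by move=> [z [->|[/ltW]]]; exists z. Qed.

Section Step.
Context (S : set O) (x : O -> W) (statS : stationary S).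
Context (xhull : forall e, S e -> hull (x e)).
Context (xabove : forall e, S e -> ~ below e (x e)).

Let x_above e dl : S dl -> e < dl -> u e < x dl.
Proof. by move=> /xabove /nbelow H /H. Qed.

(** x dl reaches the block between e and dl within radius v. *)
Definition visits (e dl v : O) : Prop :=
  exists q, [/\ ~ below e q, below dl q & rho q (x dl) <= v].

Lemma visits_mono e e' dl v : e <= e' -> visits e' dl v -> visits e dl v.
Proof.
by move=> ee' [q [nq bq rq]]; exists q; split=> // /(below_mono ee').
Qed.

Definition clusters v dl e : Prop :=
  forall z, z < e -> exists q, [/\ u z < q, below e q & rho q (x dl) <= v].

(** If x dl had neighbours of radius v cofinally below e for all e of a
    stationary set B, these neighbours would form longer and longer chains of
    the tree order of radius v, and the rank p v (x dl) would exceed mu.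
    Visits at e imply visits at all smaller places, so the points dl chosen for
    one e serve all of them. *)
Lemma clustering_rare (v : O) (B : set O) : v < nu ->
  (forall e, B e -> stationary [set dl | [/\ S dl, e < dl & visits e dl v]]) ->
  (forall e, B e -> exists F, forall dl, S dl -> e < dl -> visits e dl v ->
     closed_pt F dl -> clusters v dl e) -> ~ stationary B.
Proof.
move=> vnu sv HB sB.
have [F HF] := choice_on HB id.
have [H HH] := diagonal_closed hO F.
have [_ up _] := hp.
pose R (m em : O) := B em /\ forall dl e, closed_pt H dl -> B e -> em <= e ->
    S dl -> e < dl -> visits e dl v ->
    forall q, ~ below em q -> q < x dl -> rho q (x dl) <= v -> m <= p v q.
have Q (m : O) : exists em, R m em.
  elim: (wfO m) => {}m _ IH.
  have [|e' He'] := @choice_on O O [set m' | m' < m] R _ m; first by move=> m' /IH.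
  have [b Hb] := countable_bounded hO (sub_countable (card_image_le e' _) (countable_lt hO m)).
  have [em Bem [_ bem]] := stat_unbounded id b sB.
  exists em; split=> // dl e cH Be eme Sdl edl vis q nq qx rq.
  rewrite leNgt; apply/negP => pm.
  have emdl : em < dl by exact: le_lt_trans edl.
  have e'em : e' (p v q) < em by apply: lt_trans bem; apply: Hb; exists (p v q).
  have acc := HF em Bem dl Sdl emdl (visits_mono eme vis) (HH dl cH em emdl).
  have [q' [uq' bq' rq']] := acc _ e'em.
  have q'q := below_lt bq' nq.
  have [_ Hm'] := He' _ pm.
  have : p v q <= p v q'.
    apply: (Hm' dl e) => //.
    - exact: le_trans (ltW e'em) eme.
    - by apply/nbelow => z ze; apply: lt_trans uq'; exact: hu.
    - exact: lt_trans qx.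
  by rewrite leNgt up //; exact: (sub_down q'q qx).
have [m mum] := omega1_gt hO mu.
have [em [Bem Hem]] := Q m.
have [dl [Sdl edl vis] cH] := sv em Bem H.
have [q [nq bq rq]] := vis.
have qx : q < x dl by apply: below_lt bq _; exact: xabove.
have := Hem dl em cH Bem (lexx _) Sdl edl vis q nq qx rq.
rewrite leNgt (le_lt_trans _ mum) // hull_rank //.
by apply: hull_down (xhull Sdl) qx _; exact: le_lt_trans vnu.
Qed.

(** y is the leftmost point beyond e reached by x dl within a certain radius,
    and no point between u dd and y is reached within that radius.  The point c
    bounds the part of the trace of x dl below dl: it minimizes the value on
    the block, so the trace contains nothing of the block to the right of c. *)
Definition steps_to (y : W) (e dd z dl : O) : Prop :=
  [/\ S dl, e < dl, y < x dl,
    forall w, u dd < w -> w < y -> rho y (x dl) < rho w (x dl) &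
    exists c, [/\ c <= u z, ~ below e c & forall w, ~ below e w -> below dl w ->
       rho c (x dl) <= rho w (x dl)]].

(** All choices are made by pressing down, in this order: the radius v within
    which x dl visits the block between e and dl, the bound below e of its
    neighbours of radius v (available by [clustering_rare]), the bound z below
    dl of the trace, the leftmost point y, and at last, as e varies, the bound
    dd below e. *)
Lemma step : exists (T : set O) (y : O -> W) (dd : O), stationary T /\ forall e, T e ->
  [/\ hull (y e), ~ below e (y e) & exists z, stationary (steps_to (y e) e dd z)].
Proof.
have /choice[w Hw] : forall e, exists v, v < nu /\
    stationary [set dl | [/\ S dl, e < dl & visits e dl v]].
  move=> e; have [|v vnu sv] := stat_pigeonhole hO (f := fun dl => rho (u e) (x dl))
      (countable_lt hO nu) (stat_gt e statS).
    by move=> dl [Sdl edl]; apply: hull_rho; [exact: xhull|exact: x_above].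
  exists v; split=> //; apply: stat_sub sv => dl [[Sdl edl] rv]; split=> //.
  exists (u e); split; [exact: nbelow_u|by exists e|by rewrite rv].
have [|v vnu sT0'] := stat_pigeonhole hO (f := w) (countable_lt hO nu) (statT hO).
  by move=> e _; have [] := Hw e.
pose T0 := [set e | w e = v].
have {sT0'} sT0 : stationary T0 by apply: stat_sub sT0' => e [].
have sv e : T0 e -> stationary [set dl | [/\ S dl, e < dl & visits e dl v]].
  by move=> <-; have [] := Hw e.
pose B : set O := [set e | exists F, forall dl, S dl -> e < dl -> visits e dl v ->
     closed_pt F dl -> clusters v dl e].
have nB : ~ stationary (T0 `&` B).
  by apply: (clustering_rare vnu) => [e [/sv]|e []].
have sT1 := stat_split hO sT0 nB.
pose good e (k : W * O * O) := [/\ hull k.1.1, ~ below e k.1.1, k.1.2 < e &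
   stationary (steps_to k.1.1 e k.1.2 k.2)].
have [o _] := omega1_pt hO.
have /choice_on/(_ (u o, o, o))[k Hk] : forall e, (T0 `\` B) e -> exists k, good e k.
  move=> e [T0e nBe].
  (* the sets S1, s2, s3, s4 record what has been pressed down so far *)
  have s1 : stationary [set dl | [/\ S dl, e < dl, visits e dl v & ~ clusters v dl e]].
    move=> F; apply: contrapT => nF; apply: nBe; exists F => dl Sdl edl vis cF.
    by apply: contrapT => ncl; apply: nF; exists dl.
  set S1 := [set _ | _] in s1.
  have /choice_on/(_ o)[g Hg] : forall dl, S1 dl -> exists g, g < e /\
      forall q, u g < q -> below e q -> v < rho q (x dl).
    move=> dl [Sdl edl vis ncl].
    apply: contrapT => H; apply: ncl => z ze; apply: contrapT => Hz; apply: H.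
    exists z; split=> // q uq bq; rewrite ltNge; apply/negP => rq; apply: Hz.
    by exists q.
  have [|dd dde s2] := stat_pigeonhole hO (f := g) (countable_lt hO e) s1.
    by move=> dl /Hg[].
  have /choice_on/(_ (u o, u o))[yc Hyc] : forall dl, S1 dl -> exists yc : W * W,
      [/\ ~ below e yc.1, below dl yc.1, rho yc.1 (x dl) <= v &
          forall q, ~ below e q -> q < yc.1 -> v < rho q (x dl)] /\
      [/\ ~ below e yc.2, below dl yc.2 &
          forall q, ~ below e q -> below dl q -> rho yc.2 (x dl) <= rho q (x dl)].
    move=> dl [Sdl edl vis _].
    have [q [nq bq rq]] := vis.
    have [|y [ny ry] ymin] := @wf_min _ _ [set q | ~ below e q /\ rho q (x dl) <= v] wfW.
      by exists q.
    have [|_ [c [nc bc] <-] cmin] := @wf_min _ _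
        ((fun q => rho q (x dl)) @` [set q | ~ below e q /\ below dl q]) wfO.
      by exists (rho q (x dl)); exists q.
    exists (y, c); split=> /=; split=> //.
    - have [z zdl qz] := bq; exists z => //; apply: le_trans qz; exact: ymin.
    - move=> q' nq' q'y; rewrite ltNge; apply/negP => rq'.
      by have := ymin q' (conj nq' rq'); rewrite leNgt q'y.
    - by move=> q' nq' bq'; apply: cmin; exists q'.
  have /choice_on/(_ o)[h Hh] : forall dl, S1 dl -> exists h,
     [/\ h < dl, (yc dl).1 <= u h & (yc dl).2 <= u h].
    move=> dl /Hyc[[_ [z1 z1d yz1] _ _] [_ [z2 z2d yz2] _]].
    exists (Order.max z1 z2); rewrite gt_max z1d z2d; split=> //.
      by apply: le_trans yz1 (u_le _); rewrite le_max lexx.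
    by apply: le_trans yz2 (u_le _); rewrite le_max lexx orbT.
  have [|z s3] := fodor hO s2 (f := h); first by move=> dl [/Hh[]].
  (* the leftmost point lies in a countable ball around u z: it can be fixed too *)
  pose C : set W := [set q | q = u z \/ q < u z /\ rho q (u z) <= nu].
  have cC : countable C.
    have [cr _ _] := hrho.
    apply: (@sub_countable _ _ _ (\bigcup_b
        (if b then [set u z] else [set q | q < u z /\ rho q (u z) <= nu]))).
      by apply: subset_card_le => q [->|?]; [exists true|exists false].
    by apply: bigcup_countable => // -[] _; [exact: countable1|exact: cr].
  have [|y Cy s4] := stat_pigeonhole hO (f := fun dl => (yc dl).1) cC (stat_gt z s3).
    move=> dl [[[S1dl _] hdl] zdl]; have [hl yh _] := Hh dl S1dl.
    rewrite /= in hdl; rewrite hdl in yh; move: yh; rewrite le_eqVlt => /orP[/eqP|yz]; first by left.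
    right; split=> //; have [[_ _ ry _] _] := Hyc dl S1dl; have [Sdl _ _ _] := S1dl.
    have zx := x_above Sdl zdl.
    apply/ltW/(sub_down_lt yz zx); first exact: le_lt_trans vnu.
    by apply: hull_rho zx; exact: xhull.
  have P dl : ([set x | (([set dl | S1 dl] `&` [set x | g x = dd]) `&`
      [set x | h x = z]) x /\ z < x] `&` [set x | (yc x).1 = y]) dl ->
     [/\ S1 dl, g dl = dd, h dl = z & (yc dl).1 = y] by move=> [[[[]]]].
  have [dl0 /P[S10 _ _ y0] _] := s4 id.
  have [[ny0 by0 ry0 _] _] := Hyc dl0 S10; have [Sdl0 _ _ _] := S10.
  exists (y, dd, z); split=> //=.
  - rewrite -y0; apply: hull_down (xhull Sdl0) _ (le_lt_trans ry0 vnu).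
    by apply: below_lt by0 _; exact: xabove.
  - by rewrite -y0.
  - apply: stat_sub s4 => dl /P[S1dl gdl hdl ydl].
    have [[ny yb ry ymin] [nc cb cmin]] := Hyc dl S1dl.
    have [_ gavoid] := Hg dl S1dl; have [_ _ cz] := Hh dl S1dl.
    rewrite ydl in ny yb ry ymin; rewrite gdl in gavoid; rewrite hdl in cz.
    case: S1dl => Sdl edl _ _; split=> //.
    + by apply: below_lt yb _; exact: xabove.
    + move=> w' dw wy; apply: le_lt_trans ry _.
      by have [bw|nw] := pselect (below e w'); [exact: gavoid|exact: ymin].
    + by exists (yc dl).2.
have [|dd sT] := fodor hO sT1 (f := fun e => (k e).1.2); first by move=> e /Hk[].
exists ((T0 `\` B) `&` [set e | (k e).1.2 = dd]), (fun e => (k e).1.1), dd.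
split=> // e [Te /= <-]; have [hy ny _ st] := Hk e Te; split=> //.
by exists (k e).2.
Qed.

End Step.

(** The points below the supremum of u, from which the bounds of the game are taken. *)
Definition dominated : set W := [set m | exists z, m <= u z].

Lemma dominated_max x y : dominated x -> dominated y -> dominated (Order.max x y).
Proof.
move=> [a xa] [b yb]; exists (Order.max a b); rewrite ge_max.
by rewrite (le_trans xa) ?(le_trans yb) //; apply: u_le; rewrite le_max lexx ?orbT.
Qed.

(** Induction on n, each time one step further to the left.  The bound dd does
    not depend on e, so that a common starting point a remains possible. *)
Lemma levels (Y : set O) n : ~ countable Y ->
  exists (T : set O) (y : O -> W) (dd : O), stationary T /\ forall e, T e ->
  [/\ hull (y e), ~ below e (y e) & exists z, forall a, u dd < a -> below e a ->
     extendable rho a dominated (u @` Y) n (u z) (y e)].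
Proof.
move=> ncY; have [o _] := omega1_pt hO.
have domu z : dominated (u z) by exists z.
elim: n => [|n [S [x [d0 [sS HS]]]]].
  have [f Hf] := uncountable_stat_next hO ncY.
  exists setT, (fun e => u (f e)), o; split; first exact: statT.
  move=> e _; split; first by exists (f e); left.
    by apply/nbelow => z ze; apply: hu; apply: lt_le_trans ze _; have [] := Hf e.
  exists o => a _ _; split=> //; exists (f e) => //; by have [] := Hf e.
have [||T [y [d1 [sT HT]]]] := @step S x sS.
- by move=> e /HS[].
- by move=> e /HS[].
exists T, y, (Order.max d0 d1); split=> // e Te.
have [hy ny [z st]] := HT e Te; split=> //; exists z => a da ba.
have d0a : u d0 < a by apply: le_lt_trans da; apply: u_le; rewrite le_max lexx.
have d1a : u d1 < a by apply: le_lt_trans da; apply: u_le; rewrite le_max lexx orbT.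
have ay := below_lt ba ny.
split=> // [|m [t mt]].
  by have [t yt] := hull_bounded hy; exists t.
have [dl [Sdl edl yx lt [c [cz nc cmin]]] [_ tdl]] := stat_unbounded id t st.
have [hx nx [z' ext]] := HS dl Sdl.
exists (x dl), (u z'); split; last by apply: ext => //; exact: below_mono (ltW edl) ba.
split=> //.
- by apply: le_lt_trans mt _; move/nbelow: nx; exact.
- split; [exact: ltW|exact: ltW|move=> _ w aw wy].
  by apply: lt => //; exact: lt_le_trans aw.
- move=> w [aw wx H] yw; have [bw|nw] := pselect (below dl w); last first.
    by right; apply: le_lt_trans mt _; move/nbelow: nw; exact.
  left; apply: le_trans cz; rewrite leNgt; apply/negP => cw.
  have nbw : ~ below e w.
    by apply/nbelow => t' t'e; apply: lt_trans yw; move/nbelow: ny; exact.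
  have := cmin w nbw bw; rewrite leNgt H //; last by apply: ltW; exact: below_lt ba nc.
  by apply: below_lt bw nx.
Qed.

Lemma confined_colours (A Y1 Y2 : set O) i :
  ~ countable A -> ~ countable Y1 -> ~ countable Y2 ->
  exists a y1 y2, [/\ A a, Y1 y1, Y2 y2, u a < u y1 & u y1 < u y2] /\
    logn 2 (osc rho (u a) (u y1) (u y2)) = i.
Proof.
move=> ncA nc1 nc2.
have [T1 [x1 [d1 [s1 H1]]]] := levels (2 ^ i.+1).+1 nc1.
have [T2 [x2 [d2 [s2 H2]]]] := levels (2 ^ i.+1).+1 nc2.
have [a Aa da] := uncountable_unbounded hO ncA (Order.max d1 d2).
move: da; rewrite gt_max => /andP[d1a d2a].
have [e1 Te1 [_ ae1]] := stat_unbounded id a s1.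
have [h1 n1 [z1 ext1]] := H1 e1 Te1.
have [t1 xt1] := hull_bounded h1.
have [e2 Te2 [_ ]] := stat_unbounded id (Order.max a (Order.max z1 t1)) s2.
rewrite !gt_max => /and3P[ae2 z1e2 t1e2].
have [h2 n2 [z2 ext2]] := H2 e2 Te2.
have ba e : a < e -> below e (u a) by exists a.
have [|||g [t [[y1 Y1y1 <-] [y2 Y2y2 <-] ag gt E]]] :=
  @all_valuations _ _ _ _ wfO wfW rho hrho (u a) dominated dominated_max (u @` Y1) (u @` Y2) i
  (x1 e1) (u z1) (x2 e2) (u z2) _ _ _ (ext1 (u a) (hu d1a) (ba _ ae1)) (ext2 (u a) (hu d2a) (ba _ ae2)).
- exact: below_lt (ba _ ae1) n1.
- by apply: le_lt_trans xt1 _; move/nbelow: n2; exact.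
- by move/nbelow: n2; exact.
by exists a, y1, y2.
Qed.

End Bounded.

(** * The three kinds of sequences *)

Section Types.
Context {d d' : Order.disp_t} {O : orderType d} {W : orderType d'}.
Context (hO : omega1_like O).
Context (rho : W -> W -> O) (hrho : subadditive rho).
Context (p : O -> W -> O) (hp : rank_for rho p).
Local Open Scope order_scope.
Local Open Scope classical_set_scope.

Let wfO : wf_order O := let: And3 h _ _ := hO in h.

(** The rank of b in the tree order of radius rho a b; it is at least rho a b. *)
Definition height (a b : W) : O := p (rho a b) b.

Definition spread (t : W) (u : O -> W) : Prop :=
  (forall x, t < u x) /\ forall x y, height t (u x) = height t (u y) -> x = y.

Definition diverging (u : O -> W) : Prop :=
  (forall x, exists b, forall y, x < y -> height (u x) (u y) <= b) /\
  forall v (A : set O), ~ countable A ->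
    exists x y, [/\ A x, A y, x < y & v < rho (u x) (u y)].

Definition confined (u : O -> W) : Prop :=
  exists nu mu, (forall x y, x < y -> rho (u x) (u y) < nu) /\
    forall v x, v < nu -> p v (u x) <= mu.

Definition increasing (phi : O -> O) := forall x y, x < y -> phi x < phi y.

Lemma increasing_lt d1 d2 (T1 : orderType d1) (T2 : orderType d2) (f : T1 -> T2) :
  (forall x y, x < y -> f x < f y) -> forall x y, (f x < f y) = (x < y).
Proof. by move=> H; apply: leW_mono; apply: le_mono. Qed.

Lemma increasing_injective d1 d2 (T1 : orderType d1) (T2 : orderType d2) (f : T1 -> T2) :
  (forall x y, x < y -> f x < f y) -> forall x y, f x = f y -> x = y.
Proof.
by move=> H x y E; case: (ltgtP x y) => // /H; rewrite E ltxx.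
Qed.

Lemma uncountable_image T U (f : T -> U) (A : set T) :
  (forall x y, A x -> A y -> f x = f y -> x = y) -> ~ countable A -> ~ countable (f @` A).
Proof.
move=> finj ncA cf; apply: ncA; apply: (inj_countable cf) finj.
by move=> x Ax; exists x.
Qed.

Lemma spread_sub t u phi : increasing phi -> spread t u -> spread t (u \o phi).
Proof.
move=> iphi [tu inj]; split=> [x|x y /inj]; first exact: tu.
exact: increasing_injective.
Qed.

Lemma diverging_sub u phi : increasing phi -> diverging u -> diverging (u \o phi).
Proof.
move=> iphi [bd unb]; split=> [x|v A ncA].
  by have [b Hb] := bd (phi x); exists b => y /iphi; exact: Hb.
have [|_ [_ [[x Ax <-] [y Ay <-] xy vr]]] := unb v (phi @` A).
  by apply: uncountable_image => // x y _ _; exact: increasing_injective.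
exists x, y; split=> //.
by rewrite -(increasing_lt iphi).
Qed.

Lemma confined_sub u phi : increasing phi -> confined u -> confined (u \o phi).
Proof.
move=> iphi [nu [mu [H1 H2]]]; exists nu, mu; split=> [x y /iphi|v x]; [exact: H1|exact: H2].
Qed.

(** The closed points of a function that bounds the N x are N-free. *)
Lemma free_increasing (N : O -> O -> Prop) : (forall x, countable [set y | N x y]) ->
  exists2 phi, increasing phi & forall x y, x < y -> ~ N (phi x) (phi y).
Proof.
move=> cN.
have /choice[F HF] : forall x, exists b, forall y, N x y -> y < b.
  by move=> x; exact: (countable_bounded hO (cN x)).
have nc : ~ countable (closed_pt F).
  apply: (stat_uncountable hO); apply: stat_sub (statI_closed F (statT hO)).
  by move=> x [].
have [phi [iphi cphi]] := increasing_enum hO nc.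
exists phi => // x y /iphi xy /HF; rewrite ltNge => /negP; apply.
by have [_ /(_ _ xy) /ltW] := cphi y.
Qed.

Lemma injective_part (f : O -> O) (A : set O) : ~ countable (f @` A) ->
  exists phi, [/\ increasing phi, forall x, A (phi x) & forall x y, f (phi x) = f (phi y) -> x = y].
Proof.
move=> nc; pose B := [set x | A x /\ forall y, A y -> f y = f x -> x <= y].
have ncB : ~ countable B.
  move=> cB; apply: nc; apply: (@sub_countable _ _ _ (f @` B)).
    apply: subset_card_le => _ [x Ax <-].
    have [|y [Ay fy] ymin] := @wf_min _ _ [set y | A y /\ f y = f x] wfO; first by exists x.
    by exists y => //; split=> // z Az fz; apply: ymin; split=> //; rewrite fz fy.
  exact: sub_countable (card_image_le _ _) cB.
have [phi [iphi Bphi]] := increasing_enum hO ncB.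
exists phi; split=> // [x|x y E]; first by case: (Bphi x).
apply: (increasing_injective iphi); apply/eqP; rewrite eq_le.
by rewrite (Bphi x).2 ?(Bphi y).2 //; [case: (Bphi x)|case: (Bphi y)].
Qed.

(** If u is neither spread nor diverging, rho is bounded on an uncountable part
    of u; take the strict bound nu to be the least possible.  If p v were
    unbounded for some v < nu, then by minimality of nu some x0 would have
    rho >= v to uncountably many points, and height(x0, . ), which is at least
    p v there, would be unbounded. *)
Lemma trichotomy (u : O -> W) : (forall x y, x < y -> u x < u y) ->
  exists2 phi, increasing phi &
  [\/ exists t, spread (u t) (u \o phi), diverging (u \o phi) | confined (u \o phi)].
Proof.
move=> iu; have [ple pup pmono] := hp; have [crho _ down] := hrho.
have [[t nct]|] := pselect (exists t, ~ countable ((fun y => height (u t) (u y)) @` [set y | t < y])).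
  have [phi [iphi tphi inj]] := injective_part nct.
  by exists phi => //; apply: Or31; exists t; split=> // x; apply: iu; exact: tphi.
move=> noI.
have bd x : exists b, forall y, x < y -> height (u x) (u y) <= b.
  have cx : countable ((fun y => height (u x) (u y)) @` [set y | x < y]).
    by apply: contrapT => nc; apply: noI; exists x.
  have [b Hb] := countable_bounded hO cx.
  by exists b => y xy; apply/ltW/Hb; exists y.
have [unb|] := pselect (forall v (A : set O), ~ countable A ->
    exists x y, [/\ A x, A y, x < y & v < rho (u x) (u y)]).
  by exists id => //; apply: Or32; split.
move=> /existsNP[v0 /existsNP[A0 /not_implyP[ncA0 HA0]]].
pose NU := [set nu | exists2 phi, increasing phi & forall x y, x < y -> rho (u (phi x)) (u (phi y)) < nu].
(* NU is not empty: it contains any element above v0 *)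
have [|nu [phi iphi Hnu] numin] := @wf_min _ _ NU wfO.
  have [phi [iphi Aphi]] := increasing_enum hO ncA0.
  have [nu vnu] := omega1_gt hO v0.
  exists nu, phi => // x y xy; apply: le_lt_trans vnu.
  rewrite leNgt; apply/negP => lt; apply: HA0; exists (phi x), (phi y).
  by split=> //; exact: iphi.
exists phi => //; apply: Or33.
have bv v : v < nu -> exists b, forall x, p v (u (phi x)) <= b.
  move=> vnu; apply: contrapT => nb.
  have ncp : ~ countable ((fun x => p v (u (phi x))) @` setT).
    move=> /(countable_bounded hO)[b Hb]; apply: nb; exists b => x.
    by apply/ltW/Hb; exists x.
  have [psi [ipsi _ inj]] := injective_part ncp.
  have [[x0 nc0]|H] := pselect (exists x0, ~ countable [set y | x0 < y /\ 
      v <= rho (u (phi (psi x0))) (u (phi (psi y)))]).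
    apply: nc0; have [b Hb] := bd (phi (psi x0)).
    apply: (@inj_countable _ _ (fun y => p v (u (phi (psi y)))) _ [set y | y <= b]
      (countable_le hO b)) => [y [xy vr]|y z _ _]; last exact: inj.
    apply: le_trans (pmono _ _ _ vr) _; apply: Hb.
    by apply: iphi; apply: ipsi.
  have [|chi ichi Hchi] := @free_increasing (fun x y =>
      x < y /\ v <= rho (u (phi (psi x))) (u (phi (psi y)))).
    by move=> x; apply: contrapT => nc; apply: H; exists x.
  have /numin : NU v.
    exists (phi \o psi \o chi) => [x y /ichi /ipsi /iphi //|x y xy /=].
    rewrite ltNge; apply/negP => vr; apply: (Hchi x y xy); split=> //.
    exact: ichi.
  by rewrite leNgt vnu.
have [o _] := omega1_pt hO.
have [b Hb] := choice_on (A := [set v | v < nu]) bv o.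
have [mu Hmu] := countable_bounded hO (sub_countable (card_image_le b _) (countable_lt hO nu)).
exists nu, mu; split=> // v x vnu; apply: le_trans (Hb v vnu x) _.
by apply/ltW/Hmu; exists v.
Qed.

Definition typed (u : O -> W) (phi : O -> O) : Prop :=
  [\/ exists t, spread (u t) (u \o phi), diverging (u \o phi) | confined (u \o phi)].

Lemma typed_sub u phi psi : increasing psi -> typed u phi -> typed u (phi \o psi).
Proof.
move=> ipsi [[t st]|dv|cf]; [apply: Or31; exists t|apply: Or32|apply: Or33].
- exact: (spread_sub ipsi st).
- exact: (diverging_sub ipsi dv).
- exact: (confined_sub ipsi cf).
Qed.

Lemma typed_family k (u : 'I_k -> O -> W) : (forall j x y, x < y -> u j x < u j y) ->
  exists2 phi, increasing phi & forall j, typed (u j) phi.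
Proof.
move=> iu.
suff H n : exists2 phi, increasing phi & forall j : 'I_k, (j < n)%N -> typed (u j) phi.
  by have [phi iphi Hphi] := H k; exists phi => // j; exact: Hphi.
elim: n => [|n [phi iphi IH]]; first by exists id.
have [nk|kn] := ltnP n k; last first.
  by exists phi => // j _; apply: IH; exact: leq_trans kn.
pose j0 := Ordinal nk.
have [|psi ipsi tpsi] := @trichotomy (u j0 \o phi); first by move=> x y /iphi; exact: iu.
exists (phi \o psi) => [x y /ipsi/iphi //|j].
rewrite ltnS leq_eqVlt => /orP[/eqP jn|jn]; last exact: typed_sub (IH j jn).
have -> : j = j0 by exact: val_inj.
case: tpsi => [[t st]|dv|cf]; [apply: Or31; exists (phi t)|apply: Or32|apply: Or33] => //.
Qed.

Variable mu : O -> O -> nat -> nat.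

Definition marked (i : nat) (x : O) : Prop :=
  forall B, x <= B -> exists N, forall n, (N <= n)%N ->
     exists2 z, z < x & forall A, z <= A -> A < x -> mu A B n = i.

(** The order of the three points tells which case applies: t < l in the
    spread case, l < t < g in the diverging case, g < t in the confined one. *)
Definition triple_colour (l g t : W) (n : nat) : nat :=
  if t < l then mu (height t l) (height t g) n
  else if t < g then mu (rho l g) (rho t g) n
  else logn 2 (osc rho l g t).

(** What the spread and the diverging case have in common: above any closed
    marked dl, every late enough eta has a partner t such that uncountable sets
    contain some x < dl for which the triple has the required colour.  The
    function F for the uncountable set is fixed before dl, which lets the set
    be chosen last. *)
Definition winning (u : O -> W) (phi : O -> O) : Prop :=
  exists G F, forall i dl, marked i dl -> closed_pt G dl ->
  exists b, forall eta, b < eta -> exists t N, [/\ t != phi eta,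
    forall x, x < dl -> t != phi x &
    forall n (X : set O), (N <= n)%N -> ~ countable X -> closed_pt (F X) dl ->
      exists x, [/\ X x, x < dl & triple_colour (u (phi x)) (u (phi eta)) (u t) n = i]].

(** Take A = height(t, u_x) and B = height(t, u_eta).  Injectivity makes A
    unbounded on every uncountable set of x, and B at least dl for all but
    countably many eta. *)
Lemma spread_winning u phi t : (forall x y, x < y -> u x < u y) -> increasing phi ->
  spread (u t) (u \o phi) -> winning u phi.
Proof.
move=> iu iphi [tu inj].
pose H x := height (u t) (u (phi x)).
have /choice[F HF] : forall X : set O, exists F : O -> O, ~ countable X ->
    forall z, exists x, [/\ X x, x < F z & z <= H x].
  move=> X; have [cX|ncX] := pselect (countable X); first by exists id.
  have /choice[F HF] : forall z, exists b, exists x, [/\ X x, x < b & z <= H x].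
    move=> z; have nc : ~ countable (H @` X).
      by apply: uncountable_image => // x y _ _; exact: inj.
    have [_ [x Xx <-] zx] := uncountable_unbounded hO nc z.
    by have [b xb] := omega1_gt hO x; exists b, x; split=> //; exact: ltW.
  by exists F.
have /choice[G0 HG0] : forall z, exists b, H z < b by move=> z; exact: omega1_gt.
exists G0, F => i dl mk cG.
have cb : countable [set x | H x < dl].
  by apply: (@inj_countable _ _ H _ [set y | y < dl] (countable_lt hO dl)) => // x y _ _; exact: inj.
have [b Hb] := countable_bounded hO cb.
exists b => eta beta; have Bge : dl <= H eta.
  by rewrite leNgt; apply/negP => /Hb; rewrite ltNge ltW.
have [N HN] := mk _ Bge; exists t, N.
have tphi x : t != phi x by apply/eqP => E; have := tu x; rewrite /= E ltxx.
split=> // n X Nn ncX [_ cF].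
have [z zdl Hz] := HN n Nn.
have [x [Xx xF zH]] := HF X ncX z.
have xdl : x < dl by exact: lt_trans (cF z zdl).
exists x; split=> //; rewrite /triple_colour (tu x) -/(H x) -/(H eta).
apply: Hz => //; apply: lt_trans (HG0 x) _; exact: (cG.2 _ xdl).
Qed.

(** Here A = rho(u_x, u_eta) and B = rho(t, u_eta).  Two points at mutual
    distance at least dl cannot both be closer than dl to u_eta, which gives t;
    likewise for the x below dl. *)
Lemma diverging_winning u phi : (forall x y, x < y -> u x < u y) -> increasing phi ->
  diverging (u \o phi) -> winning u phi.
Proof.
move=> iu iphi [bd unb]; have [ple pup pmono] := hp; have [crho _ down] := hrho.
pose r x y := rho (u (phi x)) (u (phi y)).
have iup x y : x < y -> u (phi x) < u (phi y) by move/iphi/iu.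
have dn x y z : x < y -> y < z -> r x y <= Order.max (r x z) (r y z).
  move=> xy yz; apply: (down _ _ _ _ (iup x y xy) (iup y z yz)); by rewrite le_max lexx ?orbT.
have /choice[F HF] : forall X : set O, exists F : O -> O, ~ countable X ->
    forall z, exists x y, [/\ X x, X y, x < y, y < F z & z < r x y].
  move=> X; have [cX|ncX] := pselect (countable X); first by exists id.
  have /choice[F HF] : forall z, exists b, exists x y, [/\ X x, X y, x < y, y < b & z < r x y].
    move=> z; have [x [y [Xx Xy xy zr]]] := unb z X ncX.
    by have [b yb] := omega1_gt hO y; exists b, x, y.
  by exists F.
have /choice[G0 HG0] : forall z, exists b, forall y, z < y -> r z y < b.
  move=> z; have [b Hb] := bd z; have [b' bb'] := omega1_gt hO b.
  exists b' => y zy; apply: le_lt_trans bb'; apply: le_trans (Hb y zy).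
  exact: ple.
exists G0, F => i dl mk cG.
have rlt x y : x < dl -> x < y -> r x y < dl.
  by move=> xdl xy; apply: lt_trans (HG0 x y xy) _; exact: (cG.2 _ xdl).
have ncT : ~ countable [set: O] by case: hO.
have [x1 [y1 [_ _ xy1 dlr]]] := unb dl setT ncT.
exists (Order.max dl y1) => eta; rewrite gt_max => /andP[dleta y1eta].
have [c [ceta dlc]] : exists c, c < eta /\ dl <= r c eta.
  have := dn x1 y1 eta xy1 y1eta; rewrite le_max => /orP[h|h].
    exists x1; split; first exact: lt_trans y1eta.
    by apply: le_trans h; exact: ltW.
  by exists y1; split=> //; apply: le_trans h; exact: ltW.
have dlc' : dl <= c.
  by rewrite leNgt; apply/negP => cdl; have := rlt c eta cdl ceta; rewrite ltNge dlc.
have [N HN] := mk _ dlc; exists (phi c), N; split.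
- by rewrite lt_eqF // iphi.
- by move=> x xdl; rewrite gt_eqF // iphi //; exact: lt_le_trans dlc'.
move=> n X Nn ncX [_ cF]; have [z zdl Hz] := HN n Nn.
have [x [y [Xx Xy xy yF zr]]] := HF X ncX z.
have ydl : y < dl by exact: lt_trans (cF z zdl).
have xdl : x < dl by exact: lt_trans ydl.
have [w [Xw wdl zw]] : exists w, [/\ X w, w < dl & z <= r w eta].
  have := dn x y eta xy (lt_trans ydl dleta); rewrite le_max => /orP[h|h].
    by exists x; split=> //; apply: le_trans h; exact: ltW.
  by exists y; split=> //; apply: le_trans h; exact: ltW.
exists w; split=> //; rewrite /triple_colour.
have wc : w < c by exact: lt_le_trans dlc'.
rewrite ltNge (ltW (iup _ _ wc)) /= (iup _ _ ceta); apply: Hz => //.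
by apply: rlt => //; exact: lt_trans dleta.
Qed.

End Types.

(** * Decoding a triple from a finite set of reals *)

Section Reals.
Context (W : Type) (r : W -> nat -> bool).
Hypothesis r_inj : forall a b, (forall n, r a n = r b n) -> a = b.

Definition agree (m : nat) (a b : W) : Prop := forall n, (n < m)%N -> r a n = r b n.

Lemma agree_sym m a b : agree m a b -> agree m b a.
Proof. by move=> H n nm; rewrite H. Qed.

Lemma agree_trans m a b c : agree m a b -> agree m b c -> agree m a c.
Proof. by move=> H1 H2 n nm; rewrite H1 // H2. Qed.

Lemma agree_le m n a b : (m <= n)%N -> agree n a b -> agree m a b.
Proof. by move=> mn H k km; apply: H; exact: leq_trans mn. Qed.

(** The first place where the two reals differ; 0 by default, for equal reals. *)
Definition delta (a b : W) : nat :=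
  xget 0%N [set n | agree n a b /\ r a n != r b n].

Lemma deltaP a b : a <> b -> agree (delta a b) a b /\ r a (delta a b) != r b (delta a b).
Proof.
move=> ab; rewrite /delta; case: xgetP => // H.
have ex : exists n, r a n != r b n.
  apply: contrapT => nex; apply: ab; apply: r_inj => n; apply/eqP.
  by apply/negPn/negP => h; apply: nex; exists n.
case: (H (ex_minn ex)); case: ex_minnP => n rn mn; split=> // k kn; apply/eqP.
by apply/negPn/negP => /mn; rewrite leqNgt kn.
Qed.

Lemma delta_agree a b m : a <> b -> agree m a b <-> (m <= delta a b)%N.
Proof.
move=> ab; have [ag ne] := deltaP ab; split=> [H|le]; last exact: agree_le ag.
by rewrite leqNgt; apply/negP => lt; rewrite H ?eqxx in ne.
Qed.

Lemma delta_eq a b n : agree n a b -> r a n != r b n -> delta a b = n.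
Proof.
move=> ag ne; have ab : a <> b by move=> E; rewrite E eqxx in ne.
apply/eqP; rewrite eqn_leq; apply/andP; split; last exact/delta_agree.
rewrite leqNgt; apply/negP => lt; have [ag' _] := deltaP ab.
by rewrite ag' ?eqxx in ne.
Qed.

Lemma delta_sym a b : a <> b -> delta a b = delta b a.
Proof.
move=> ab; have [ag ne] := deltaP ab; symmetry; apply: delta_eq; first exact: agree_sym.
by rewrite eq_sym.
Qed.

(** The prefix of length n, read in binary after a leading 1: prefixes of all
    lengths have different codes, and longer prefixes have larger ones. *)
Fixpoint code (a : W) (n : nat) : nat := if n is m.+1 then (code a m).*2 + r a m else 1.

Lemma code_lt a n : (2 ^ n <= code a n < 2 ^ n.+1)%N.
Proof.
elim: n => [|n /andP[IH1 IH2]] //=; rewrite -muln2 !expnS in IH1 IH2 *.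
by case: (r a n) => /=; lia.
Qed.

Lemma agree_code m a b : agree m a b -> code a m = code b m.
Proof.
elim: m => //= m IH H; rewrite IH ?H //; exact: (agree_le _ H).
Qed.

Lemma code_eq a b n m : code a n = code b m -> n = m /\ agree n a b.
Proof.
elim: n m => [|n IH] [|m] //=.
- have /andP[h _] := code_lt b m; have := expn_gt0 2 m; rewrite -muln2; lia.
- have /andP[h _] := code_lt a n; have := expn_gt0 2 n; rewrite -muln2; lia.
move=> E; have [En Er] : code a n = code b m /\ r a n = r b m.
  by move: E; rewrite -!muln2; case: (r a n); case: (r b m) => /= E; split=> //; lia.
have [nm ag] := IH m En; subst m; split=> // k; rewrite ltnS leq_eqVlt.
by case/orP=> [/eqP->//|]; exact: ag.
Qed.

(** The code of the common prefix.  Unlike its length, it attains its maximum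
    over different places j of a tuple only once. *)
Definition kappa (a b : W) : nat := code a (delta a b).

Lemma kappa_sym a b : a <> b -> kappa a b = kappa b a.
Proof. by move=> ab; rewrite /kappa -(delta_sym ab); apply: agree_code; case: (deltaP ab). Qed.

Lemma delta_le_kappa a b : (delta a b <= kappa a b)%N.
Proof.
have /andP[h _] := code_lt a (delta a b); apply: leq_trans h.
by apply: ltnW; apply: ltn_expl.
Qed.

Lemma kappa_lt a b m : (delta a b < m)%N -> (kappa a b < 2 ^ m)%N.
Proof.
move=> lt; have /andP[_ h] := code_lt a (delta a b); apply: leq_trans h _.
by rewrite leq_exp2l.
Qed.

Lemma kappa_local a b b' n : a <> b -> agree n.+1 b b' -> (kappa a b <= n)%N ->
  a <> b' /\ kappa a b' = kappa a b.
Proof.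
move=> ab bb' kn; have [ag ne] := deltaP ab.
have dn : (delta a b < n.+1)%N by rewrite ltnS (leq_trans (delta_le_kappa _ _)).
have E : delta a b' = delta a b.
  apply: delta_eq; last by rewrite -(bb' _ dn).
  by apply: agree_trans ag _; apply: agree_le bb'; exact: ltnW.
split; last by rewrite /kappa E.
by move=> E'; move: ne; rewrite (bb' _ dn) E' eqxx.
Qed.

End Reals.

Section Decode.
Context {d : Order.disp_t} {W : orderType d} (r : W -> nat -> bool).
Hypothesis r_inj : forall a b, (forall n, r a n = r b n) -> a = b.
Variable col : W -> W -> W -> nat -> nat.
Local Open Scope order_scope.
Local Open Scope classical_set_scope.

(** l and g maximize kappa on F; then t has, apart from l and g, the real
    closest to that of g. *)
Definition selects (F : set W) (l g t : W) : Prop :=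
  [/\ [/\ F l, F g, F t & l < g], t <> l, t <> g,
     forall a b, F a -> F b -> a <> b -> (kappa r a b <= kappa r l g)%N &
     forall w, F w -> w <> l -> w <> g -> (delta r w g <= delta r t g)%N].

Definition decode (F : set W) : nat :=
  xget 0%N [set i | exists l g t, selects F l g t /\ col l g t (kappa r l g) = i].

Context (k : nat) (R : set W) (x y t : 'I_k -> W) (N m n : nat) (j0 : 'I_k).
Hypothesis R_sep : forall a b, R a -> R b -> agree r N a b -> a = b.
Hypothesis R_far : forall a j, R a ->
  [/\ ~ agree r N a (x j), ~ agree r N a (y j) & ~ agree r N a (t j)].
Hypothesis same : forall j, agree r N (x j) (y j) /\ agree r N (t j) (y j).
Hypothesis far : forall j j', j != j' -> ~ agree r N (y j) (y j').
Hypothesis Nm : (N <= m)%N.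
Hypothesis ty : forall j, ~ agree r m (t j) (y j).
Hypothesis xy : forall j, agree r m (x j) (y j) /\ x j <> y j.
Hypothesis kn : kappa r (x j0) (y j0) = n.
Hypothesis kltn : forall j, j != j0 -> (kappa r (x j) (y j) < n)%N.
Hypothesis mn : (2 ^ m <= n)%N.
Hypothesis xlty : x j0 < y j0.

Let F : set W := R `|` range x `|` range y `|` range t.
Let base : set W := R `|` range y `|` range t.

Lemma far_ty j j' : ~ agree r m (t j) (y j').
Proof.
move=> H; have [E|ne] := eqVneq j j'; first by subst j'; exact: (ty H).
apply: (far ne); apply: agree_trans (agree_le Nm H).
by apply: agree_sym; case: (same j).
Qed.

Lemma far_tt j j' : agree r N (t j) (t j') -> j = j'.
Proof.
move=> H; apply/eqP/negPn/negP => ne; apply: (far ne).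
apply: agree_trans (same j').2; apply: agree_trans H; apply: agree_sym; exact: (same j).2.
Qed.

Lemma base_sep a b : base a -> base b -> agree r m a b -> a = b.
Proof.
have lo c e : agree r m c e -> agree r N c e by exact: agree_le.
move=> [[Ra|[j _ <-]]|[j _ <-]] [[Rb|[j' _ <-]]|[j' _ <-]] ag.
- by apply: R_sep => //; exact: lo.
- by have [_ /(_ (lo _ _ ag))] := R_far j' Ra.
- by have [_ _ /(_ (lo _ _ ag))] := R_far j' Ra.
- by have [_ /(_ (lo _ _ (agree_sym ag)))] := R_far j Rb.
- have [->//|ne] := eqVneq j j'; by case: (far ne (lo _ _ ag)).
- by case: (@far_ty j' j); exact: agree_sym.
- by have [_ _ /(_ (lo _ _ (agree_sym ag)))] := R_far j Rb.
- by case: (@far_ty j j').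
- by have -> : j = j' by apply: far_tt; exact: lo.
Qed.

Lemma F_base a : F a -> base a \/ exists j, a = x j.
Proof.
move=> [[[Ra|[j _ <-]]|[j _ <-]]|[j _ <-]]; [left|right|left|left].
- by left; left.
- by exists j.
- by left; right; exists j.
- by right; exists j.
Qed.

Lemma base_y j : base (y j). Proof. by left; right; exists j. Qed.

(** Apart from the pairs (x j, y j), all pairs of distinct points of F differ
    before m, because x j can be replaced by y j up to there. *)
Lemma close_pair a b : F a -> F b -> a <> b -> (n <= kappa r a b)%N ->
  a = x j0 /\ b = y j0 \/ a = y j0 /\ b = x j0.
Proof.
move=> Fa Fb ab nk.
have ag : agree r m a b.
  apply/(delta_agree r_inj _ ab); rewrite leqNgt; apply/negP => lt; have H := kappa_lt lt.
  by move: (leq_trans (leq_trans H mn) nk); rewrite ltnn.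
have [Ba|[j aj]] := F_base Fa; have [Bb|[j' bj]] := F_base Fb.
- by case: ab; apply: base_sep.
- subst b; have E : a = y j'.
    by apply: base_sep => //; [exact: base_y|apply: agree_trans ag (xy j').1].
  right; subst a; have [->//|ne] := eqVneq j' j0.
  have := kltn ne; rewrite kappa_sym //; last by move=> E; apply: ab.
  by rewrite ltnNge nk.
- subst a; have E : b = y j.
    apply: base_sep => //; first exact: base_y.
    by apply: agree_sym; apply: agree_trans ag; apply: agree_sym; exact: (xy j).1.
  left; subst b; have [->//|ne] := eqVneq j j0.
  by have := kltn ne; rewrite ltnNge nk.
- subst a b; suff E : j = j' by subst j'.
  apply/eqP/negPn/negP => ne; apply: (far ne); apply: (agree_le Nm).
  by apply: agree_trans (xy j').1; apply: agree_trans ag; apply: agree_sym; exact: (xy j).1.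
Qed.

Lemma decode_spec : decode F = col (x j0) (y j0) (t j0) n.
Proof.
have Fx : F (x j0) by left; left; right; exists j0.
have Fy : F (y j0) by left; right; exists j0.
have Ft : F (t j0) by right; exists j0.
have ty0 : t j0 <> y j0 by move=> E; apply: (@ty j0); rewrite E.
have tx0 : t j0 <> x j0 by move=> E; apply: (@ty j0); rewrite E; exact: (xy j0).1.
have near w : F w -> agree r N w (y j0) -> [\/ w = x j0, w = y j0 | w = t j0].
  move=> [[[Rw|[j _ <-]]|[j _ <-]]|[j _ <-]] ag.
  - by have [_ /(_ ag)] := R_far j0 Rw.
  - have [->|ne] := eqVneq j j0; first by apply: Or31.
    by case: (far ne); apply: agree_trans ag; apply: agree_sym; exact: (same j).1.
  - have [->|ne] := eqVneq j j0; first by apply: Or32.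
    by case: (far ne).
  - have [->|ne] := eqVneq j j0; first by apply: Or33.
    by case: (far ne); apply: agree_trans ag; apply: agree_sym; exact: (same j).2.
have sel : selects F (x j0) (y j0) (t j0).
  split=> // [a b Fa Fb ab|w Fw wx wy].
    rewrite kn leqNgt; apply/negP => lt.
    have [[E1 E2]|[E1 E2]] := close_pair Fa Fb ab (ltnW lt); subst a b.
      by rewrite kn ltnn in lt.
    by rewrite kappa_sym // kn ltnn in lt.
  have [->//|wt] := pselect (w = t j0).
  have lt : (delta r w (y j0) < N)%N.
    rewrite ltnNge; apply/negP => /(delta_agree r_inj _ wy) /(near _ Fw); by case.
  apply: leq_trans (ltnW lt) _; apply/(delta_agree r_inj _ ty0).
  exact: (same j0).2.
rewrite /decode; case: xgetP => [i _ [l [g [s [[[Fl Fg Fs lg] sl sg mx mt] <-]]]]|]; last first.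
  by move=> /(_ (col (x j0) (y j0) (t j0) n)); case; exists (x j0), (y j0), (t j0); rewrite kn.
have lg' : l <> g by move=> E; rewrite E ltxx in lg.
have nk : (n <= kappa r l g)%N by rewrite -kn; apply: mx => //; case: (xy j0).
have [[E1 E2]|[E1 E2]] := close_pair Fl Fg lg' nk; subst l g; last first.
  by have := lt_trans lg xlty; rewrite ltxx.
rewrite kn; suff -> : s = t j0 by [].
have := mt _ Ft tx0 ty0 => le.
have : (N <= delta r s (y j0))%N.
  by apply: leq_trans le; apply/(delta_agree r_inj _ ty0); exact: (same j0).2.
by move/(delta_agree r_inj _ sg)/(near _ Fs); case.
Qed.

End Decode.

(** * Colouring finite sets of ordinals *)

Section Main.
Context {d d' : Order.disp_t} {O : orderType d} {W : orderType d'}.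
Context (hO : omega1_like O) (hW : omega2_like O W).
Context (rho : W -> W -> O) (hrho : subadditive rho).
Context (p : O -> W -> O) (hp : rank_for rho p).
Context (mu : O -> O -> nat -> nat) (hmu : forall i, stationary (marked mu i)).
Context (r : W -> nat -> bool).
Hypothesis r_inj : forall a b, (forall n, r a n = r b n) -> a = b.
Local Open Scope order_scope.
Local Open Scope classical_set_scope.

Context (k : nat) (k0 : (0 < k)%N) (R : set W) (x : O -> 'I_k -> W) (N : nat).
Hypothesis x_incr : forall j a b, a < b -> x a j < x b j.
Hypothesis R_sep : forall a b, R a -> R b -> agree r N a b -> a = b.
Hypothesis R_far : forall a e j, R a -> ~ agree r N a (x e j).
Hypothesis same : forall a b j, agree r N (x a j) (x b j).
Hypothesis far : forall a b j j', j != j' -> ~ agree r N (x a j) (x b j').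

Let u j e := x e j.
Let wfW : wf_order W := hW.1.

Let u_inj j a b : u j a = u j b -> a = b.
Proof. by apply: increasing_injective => ? ?; exact: x_incr. Qed.

Let dec := decode r (triple_colour rho p mu).

Lemma decode_triple a b c j m n : b != c ->
  (N <= m)%N -> (forall j', ~ agree r m (u j' c) (u j' b)) ->
  (forall j', agree r m (u j' a) (u j' b) /\ u j' a <> u j' b) ->
  kappa r (u j a) (u j b) = n -> (forall j', j' != j -> (kappa r (u j' a) (u j' b) < n)%N) ->
  (2 ^ m <= n)%N -> u j a < u j b ->
  dec (R `|` range (x a) `|` range (x b) `|` range (x c)) =
  triple_colour rho p mu (u j a) (u j b) (u j c) n.
Proof.
move=> bc Nm ty xy kn kltn mn lt.
apply: (@decode_spec _ _ r r_inj _ k R (x a) (x b) (x c) N m n j) => //.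
- by move=> e j' Re; split; exact: R_far.
- by move=> j1 j2 ne; exact: far.
Qed.

Section Typed.
Context (phi : O -> O) (iphi : increasing phi) (tphi : forall j, typed rho p (u j) phi).

Let v j e := u j (phi e).

Let v_incr j a b : a < b -> v j a < v j b.
Proof. by move=> /iphi; exact: x_incr. Qed.

Let v_inj j a b : v j a = v j b -> a = b.
Proof. by move/u_inj; exact: increasing_injective. Qed.

Definition info (q : nat) (e : O) : {ffun 'I_k -> nat} := [ffun j => code r (v j e) q].

Lemma info_agree q a b : info q a = info q b <-> forall j, agree r q (v j a) (v j b).
Proof.
split=> [/ffunP H j|H].
  by have := H j; rewrite /info !ffunE => E; have [_] := code_eq E.
by apply/ffunP => j; rewrite /info !ffunE; exact: agree_code.
Qed.

(** Condensation points: every neighbourhood of e contains uncountably many tuples. *)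
Definition good : set O := [set e | forall q, ~ countable [set e' | info q e' = info q e]].

Lemma good_meets (Z : set O) : ~ countable Z -> ~ countable (Z `&` good).
Proof.
move=> ncZ cZ; apply: ncZ.
pose C (k : nat * {ffun 'I_k -> nat}) : set O := 
  if pselect (countable [set e | info k.1 e = k.2]) then [set e | info k.1 e = k.2] else set0.
apply: (@sub_countable _ _ _ (\bigcup_b if b then Z `&` good else \bigcup_k C k)); last first.
  apply: bigcup_countable => // -[] _ //; apply: bigcup_countable => // q _.
  by rewrite /C; case: pselect.
apply: subset_card_le => e Ze; have [ge|] := pselect (good e); first by exists true.
move=> /existsNP[q /contrapT cq]; exists false => //; exists (q, info q e) => //.
by rewrite /C /=; case: pselect.
Qed.

Lemma exists_bound (f : 'I_k -> nat) : exists m, forall j, (f j <= m)%N.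
Proof. by exists (\max_j f j)%N => j; exact: leq_bigmax. Qed.

Lemma exists_boundO (f : 'I_k -> O) : exists m, forall j, f j < m.
Proof.
have [m Hm] := countable_bounded hO (sub_countable (card_image_le f setT) (countableP _)).
by exists m => j; apply: Hm; exists j.
Qed.

(** Needed in the confined case, where y and t are both taken from uncountable
    sets: these are kept apart in advance. *)
Lemma two_infos : exists q Z1 Z2, [/\ ~ countable Z1, ~ countable Z2 &
  forall a b j, Z1 a -> Z2 b -> ~ agree r q (v j b) (v j a)].
Proof.
have ncT : ~ countable [set: O] by case: hO.
have ncg := good_meets ncT.
have [o _] := omega1_pt hO.
have [a [_ ga] _] := uncountable_unbounded hO ncg o.
have [b [_ gb] ab] := uncountable_unbounded hO ncg a.
have [q Hq] := exists_bound (fun j => (delta r (v j a) (v j b)).+1).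
exists q, [set e | info q e = info q a], [set e | info q e = info q b]; split; [exact: ga|exact: gb|].
move=> a' b' j /info_agree /(_ j) aa' /info_agree /(_ j) bb' ag.
have : agree r q (v j a) (v j b).
  apply: agree_trans (agree_sym aa') _; apply: agree_trans (agree_sym ag) bb'.
have ne : v j a <> v j b by move/v_inj => E; rewrite E ltxx in ab.
by move/(delta_agree r_inj _ ne); rewrite leqNgt Hq.
Qed.

(** The tuples that are closest to the tuple of e at the place j, with n as
    common code, and that agree with it up to q at all places. *)
Definition sharp (q n : nat) (j : 'I_k) (e : O) : set O := [set e' |
  [/\ forall j', agree r q (v j' e') (v j' e) /\ v j' e' <> v j' e,
     kappa r (v j e') (v j e) = n &
     forall j', j' != j -> (kappa r (v j' e') (v j' e) < n)%N]].

(** The tuples agreeing with e up to q, apart from e itself, are distributed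
    into countably many sharp sets, according to the place and the value of the
    largest code. *)
Lemma sharp_exists q e : (N <= q)%N -> good e ->
  exists n j, (q <= n)%N /\ ~ countable (sharp q n j e).
Proof.
move=> Nq ge; apply: contrapT => H; apply: (ge q).
pose C (nj : nat * 'I_k) : set O := 
  if pselect (countable (sharp q nj.1 nj.2 e)) then sharp q nj.1 nj.2 e else set0.
apply: (@sub_countable _ _ _ (\bigcup_b if b then [set e] else \bigcup_k C k)); last first.
  apply: bigcup_countable => // -[] _; first exact: countable1.
  by apply: bigcup_countable => // nj _; rewrite /C; case: pselect.
apply: subset_card_le => a /= ia; have [->|ae] := pselect (a = e); first by exists true.
exists false => //.
have ne j : v j a <> v j e by move/v_inj.
have ag j : agree r q (v j a) (v j e) by move/info_agree: ia.
pose K j := kappa r (v j a) (v j e).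
case: (@arg_maxnP _ (Ordinal k0) xpredT K isT) => j _ jmax0.
have jmax j' : (K j' <= K j)%N by exact: jmax0.
have qd j' : (q <= delta r (v j' a) (v j' e))%N by apply/(delta_agree r_inj).
have qK : (q <= K j)%N by apply: leq_trans (qd j) (delta_le_kappa _ _ _).
have sh : sharp q (K j) j e a.
  split=> // j' jj'; rewrite ltn_neqAle [(_ <= _)%N]jmax andbT; apply/eqP => E.
  have [_ ag'] := code_eq (E : code r (v j' a) _ = code r (v j a) _).
  by apply: (far jj'); apply: agree_le ag'; exact: leq_trans Nq (qd j').
exists (K j, j) => //; rewrite /C /=; case: pselect => // nc.
by exfalso; apply: H; exists (K j), j.
Qed.

Lemma sharp_local q n j e e' : (q <= n.+1)%N -> info n.+1 e = info n.+1 e' ->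
  sharp q n j e `<=` sharp q n j e'.
Proof.
move=> qn /info_agree ag a [H1 H2 H3].
have loc j' : v j' a <> v j' e' /\ kappa r (v j' a) (v j' e') = kappa r (v j' a) (v j' e).
  apply: (kappa_local _ (H1 j').2 (ag j')) => //.
  have [->|ne] := eqVneq j' j; first by rewrite H2.
  exact: ltnW (H3 j' ne).
split=> [j'||j' ne]; rewrite ?(loc _).2 //; last exact: H3.
by split; [apply: agree_trans (H1 j').1 (agree_le qn (ag j'))|exact: (loc j').1].
Qed.

Lemma played (j : 'I_k) : exists GF : (O -> O) * (set O -> O -> O), forall i dl,
  marked mu i dl -> closed_pt GF.1 dl ->
  exists b, forall eta, b < eta -> exists t M, [/\ t != phi eta,
    forall e, e < dl -> t != phi e & confined rho p (u j \o phi) \/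
    forall n (X : set O), (M <= n)%N -> ~ countable X -> closed_pt (GF.2 X) dl ->
      exists e, [/\ X e, e < dl & triple_colour rho p mu (v j e) (v j eta) (u j t) n = i]].
Proof.
have ij : forall a b, a < b -> u j a < u j b by move=> a b; exact: x_incr.
have fromW : winning rho p mu (u j) phi -> exists GF : (O -> O) * (set O -> O -> O), forall i dl,
  marked mu i dl -> closed_pt GF.1 dl ->
  exists b, forall eta, b < eta -> exists t M, [/\ t != phi eta,
    forall e, e < dl -> t != phi e & confined rho p (u j \o phi) \/
    forall n (X : set O), (M <= n)%N -> ~ countable X -> closed_pt (GF.2 X) dl ->
      exists e, [/\ X e, e < dl & triple_colour rho p mu (v j e) (v j eta) (u j t) n = i]].
  move=> [G [F H]]; exists (G, F) => i dl mk cG; have [b Hb] := H i dl mk cG.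
  exists b => eta be; have [t [M [H1 H2 H3]]] := Hb eta be.
  by exists t, M; split=> //; right.
have [[t st]|dv|cf] := tphi j.
- by apply: fromW; exact: (spread_winning hO mu ij iphi st).
- by apply: fromW; exact: (diverging_winning hO hrho hp mu ij iphi dv).
exists (id, fun _ => id) => i dl _ _; exists dl => eta dle.
have [e ee] := omega1_gt hO eta.
exists (phi e), 0%N; split; [|move=> e' e'd|by left].
  by rewrite gt_eqF // iphi.
by rewrite gt_eqF // iphi // (lt_trans e'd) // (lt_trans dle).
Qed.

(** Choose for stationarily many dl a point eta, partners t for all places j,
    a level q beyond which these are kept apart, and a large n with a place j
    for which the sharp set of eta is uncountable; n, j, q and the information
    on eta that determines the sharp set can be made independent of dl.  The
    kind of the sequence at the place j then decides how to conclude. *)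
Lemma typed_colours i : exists a b c, [/\ a != b, b != c & a != c] /\
  dec (R `|` range (x a) `|` range (x b) `|` range (x c)) = i.
Proof.
have [q0 [Z1 [Z2 [nc1 nc2 Z12]]]] := two_infos.
have nc1g := good_meets nc1.
have /choice[GF HGF] := played.
have /choice[G HG] : forall z, exists b, forall j, (GF j).1 z < b.
  by move=> z; exact: exists_boundO.
have cG j dl : closed_pt G dl -> closed_pt (GF j).1 dl.
  by move=> [ne H]; split=> // y yd; exact: lt_trans (HG y j) (H y yd).
have sS := statI_closed G (hmu i); set S := (_ `&` _)%classic in sS.
pose conf j := confined rho p (u j \o phi).
pose good_choice dl (K : O * O * nat * 'I_k * nat) := 
  let: (eta, t, n, j, q) := K in 
  [/\ [/\ dl < eta, Z1 eta, (2 ^ q <= n)%N & (N <= q)%N /\ (q0 <= q)%N],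
      t != phi eta, forall e, e < dl -> t != phi e,
      (forall j', ~ agree r q (u j' t) (v j' eta)) /\ ~ countable (sharp q n j eta) &
      conf j \/ forall X : set O, ~ countable X -> closed_pt ((GF j).2 X) dl ->
      exists e, [/\ X e, e < dl & triple_colour rho p mu (v j e) (v j eta) (u j t) n = i]].
have [o _] := omega1_pt hO.
have /choice_on/(_ (o, o, 0%N, Ordinal k0, 0%N))[K HK] : forall dl, S dl -> exists K, good_choice dl K.
  move=> dl [mk /cG cl].
  have /choice[b Hb] := fun j => HGF j i dl mk (cl j).
  have [b' Hb'] := exists_boundO b.
  have [eta [Z1e ge] ] := uncountable_unbounded hO nc1g (Order.max dl b').
  rewrite gt_max => /andP[dle b'e].
  have /choice[t /choice[M HM]] := fun j => Hb j eta (lt_trans (Hb' j) b'e).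
  have [m1 Hm1] := exists_bound M.
  have [m2 Hm2] := exists_bound (fun j => \max_j' (delta r (u j' (t j)) (v j' eta)).+1)%N.
  (* m2 separates the partners from eta, q0 separates Z1 from Z2 *)
  pose q := maxn m2 (maxn q0 N).
  have [|n [j [qn nc]]] := @sharp_exists (maxn (2 ^ q) (maxn m1 q)) eta _ ge; first lia.
  have [H1 H2 H3] := HM j.
  have nq : (2 ^ q <= n)%N by lia.
  exists (eta, t j, n, j, q); split=> //.
  - by split=> //; split; rewrite /q; lia.
  - split=> [j' ag|].
      have ne : u j' (t j) <> v j' eta by move/u_inj => E; rewrite E eqxx in H1.
      have lt : (delta r (u j' (t j)) (v j' eta) < q)%N.
        apply: leq_trans (_ : m2 <= q)%N; last by rewrite /q; lia.
        apply: leq_trans (Hm2 j); exact: (@leq_bigmax _ (fun j' => (delta r (u j' (t j)) (v j' eta)).+1)).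
      by move/(delta_agree r_inj _ ne): ag; rewrite leqNgt lt.
    apply: contra_not nc; apply: sub_countable; apply: subset_card_le => e [A B C].
    split=> // j'; have [ag ne] := A j'; split=> //; apply: agree_le ag.
    by lia.
  - case: H3 => [|H3]; [by left|right=> X; apply: H3; by have := Hm1 j; lia].
pose f dl := let: (eta, t, n, j, q) := K dl in (n, j, q, info n.+1 eta).
have [[[[n j] q] tau] sS2] := stat_pigeonhole_count hO f sS.
set S2 := (_ `&` _)%classic in sS2.
have HS2 dl : S2 dl -> exists eta t, K dl = (eta, t, n, j, q) /\ info n.+1 eta = tau.
  by move=> [_]; rewrite /= /f; case: (K dl) => [[[[eta t] n'] j'] q'] [-> -> -> <-]; exists eta, t.
have [dl0 S20 _] := sS2 id.
have [eta0 [t0 [K0 i0]]] := HS2 dl0 S20.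
have := HK dl0 S20.1; rewrite K0 => -[[_ _ nq [Nq q0q]] _ _ [_ ncX] _].
set X := sharp q n j eta0 in ncX.
have qn : (q <= n.+1)%N by have := ltn_expl q (isT : (1 < 2)%N); lia.
have XX eta : info n.+1 eta = tau -> X `<=` sharp q n j eta.
  by move=> ie; apply: sharp_local => //; rewrite ie i0.
have [cf|ncf] := pselect (conf j).
  have [nu [m [H1 H2]]] := cf.
  pose Y1 := [set eta | exists2 dl, S2 dl & (K dl).1.1.1.1 = eta].
  have ncY : ~ countable Y1.
    apply: (unbounded_uncountable hO) => b.
    have [dl S2dl [_ bdl]] := stat_unbounded id b sS2.
    have [eta [t [Kd _]]] := HS2 dl S2dl.
    exists eta; first by exists dl => //; rewrite Kd.
    by have := HK dl S2dl.1; rewrite Kd => -[[dle _ _ _] _ _ _ _]; exact: lt_trans dle.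
  have [a [_ [c [[Xa [dl S2dl <-] Z2c lt1 lt2] E]]]] :=
    @confined_colours _ _ _ _ hO wfW rho hrho p hp (u j \o phi) (@v_incr j) nu m H1 H2
       X Y1 Z2 i ncX ncY nc2.
  have [eta [t [Kd ie]]] := HS2 dl S2dl.
  rewrite Kd /= in lt1 lt2 E.
  have := HK dl S2dl.1; rewrite Kd => -[[dle Z1e _ _] _ _ _ _].
  have [A B C] := XX eta ie a Xa.
  have ne1 : phi a != phi eta by apply/eqP => h; rewrite h ltxx in lt1.
  have ne2 : phi eta != phi c by apply/eqP => h; rewrite h ltxx in lt2.
  have ne3 : phi a != phi c by apply/eqP => h; have := lt_trans lt1 lt2; rewrite h ltxx.
  exists (phi a), (phi eta), (phi c); split=> //.
  rewrite (@decode_triple _ _ _ j q n) //; last first.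
    by move=> j'; apply: contra_not (Z12 eta c j' Z1e Z2c); exact: agree_le.
  rewrite /triple_colour ltNge (ltW (lt_trans lt1 lt2)) /= ltNge (ltW lt2) /=.
  exact: E.
have [dl S2dl cF] := sS2 ((GF j).2 X).
have [eta [t [Kd ie]]] := HS2 dl S2dl.
have := HK dl S2dl.1; rewrite Kd => -[[dle _ _ _] te tlt [agt _] [//|H]].
have [a [Xa adl E]] := H X ncX cF.
have [A B C] := XX eta ie a Xa.
have ae : a < eta by exact: lt_trans dle.
exists (phi a), (phi eta), t; split.
  by rewrite lt_eqF ?iphi // eq_sym te eq_sym tlt.
by rewrite (@decode_triple _ _ _ j q n) // 1?eq_sym //; exact: v_incr.
Qed.

End Typed.

Lemma all_colours i : exists a b c, [/\ a != b, b != c & a != c] /\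
  dec (R `|` range (x a) `|` range (x b) `|` range (x c)) = i.
Proof.
have [phi iphi tphi] := @typed_family _ _ _ _ hO rho hrho p hp k u x_incr.
exact: typed_colours iphi tphi i.
Qed.

End Main.

(** * Normal forms in an abelian group *)

Import GRing.Theory.

Section NormalForm.
Context {d : Order.disp_t} {W : orderType d} (wfW : wf_order W).
Context (G : zmodType) (gen : W -> G).
Hypothesis gen_surj : forall g, exists w, gen w = g.
Local Open Scope ring_scope.

Definition term (q : W * int) : G := gen q.1 *~ q.2.
Definition tsum (s : seq (W * int)) : G := \sum_(q <- s) term q.

Definition lower (w : W) : set G :=
  [set g | exists2 s, (forall q, q \in s -> (q.1 < w)%O) & g = tsum s].

Lemma lowerD w a b : lower w a -> lower w b -> lower w (a + b).
Proof.
move=> [s Hs ->] [t Ht ->]; exists (s ++ t); last by rewrite /tsum big_cat.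
by move=> q; rewrite mem_cat => /orP[/Hs|/Ht].
Qed.

Lemma lowerN w a : lower w a -> lower w (- a).
Proof.
move=> [s Hs ->]; exists [seq (q.1, - q.2) | q <- s].
  by move=> z /mapP[q qs zE]; rewrite zE; exact: (Hs q qs).
rewrite /tsum big_map -sumrN; apply: eq_bigr => q _.
by rewrite /term mulrNz.
Qed.

Lemma lower0 w : lower w 0.
Proof. by exists [::] => //; rewrite /tsum big_nil. Qed.

Lemma lowerB w a b : lower w a -> lower w b -> lower w (a - b).
Proof. by move=> la lb; apply: lowerD => //; exact: lowerN. Qed.

(** A choice of coefficient that depends on the coset of g only. *)
Definition coeff (w : W) (g : G) : int := xget 0 [set m | lower w (g - gen w *~ m)].

Lemma coeff_coset w a b : lower w (a - b) -> coeff w a = coeff w b.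
Proof.
move=> l; congr (xget 0 _); apply/seteqP; split => m /= H.
  suff -> : b - gen w *~ m = (a - gen w *~ m) - (a - b) by exact: lowerB.
  by rewrite [RHS]addrC opprB subrKA.
suff -> : a - gen w *~ m = (b - gen w *~ m) + (a - b) by exact: lowerD.
by rewrite [RHS]addrC subrKA.
Qed.

(** The multiple is not redundant modulo the lower generators, and its
    coefficient is the chosen one of its coset. *)
Definition reduced (q : W * int) : Prop :=
  ~ lower q.1 (term q) /\ coeff q.1 (term q) = q.2.

Definition normal (F : {fset W * int}) : Prop :=
  (forall q, q \in F -> reduced q) /\
  (forall q q', q \in F -> q' \in F -> q.1 = q'.1 -> q = q').

Lemma tsum_perm s t : perm_eq s t -> tsum s = tsum t.
Proof. by move=> st; apply: perm_big. Qed.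

Lemma tsum_cat s t : tsum (s ++ t) = tsum s + tsum t.
Proof. exact: big_cat. Qed.

Lemma tsum_fsetU (A B : {fset W * int}) : (forall q, q \in A -> q \in B -> False) ->
  tsum (enum_fset (A `|` B)%fset) = tsum (enum_fset A) + tsum (enum_fset B).
Proof.
move=> dis; rewrite -tsum_cat; apply: tsum_perm; apply: uniq_perm.
- exact: fset_uniq.
- rewrite cat_uniq !fset_uniq /= andbT; apply/hasPn => q qB; apply/negP => qA.
  exact: dis qA qB.
- by move=> q; rewrite mem_cat; apply/fsetUP/orP.
Qed.

Lemma tsum_fset1 q : tsum (enum_fset [fset q]%fset) = term q.
Proof.
rewrite (@tsum_perm _ [:: q]) ?/tsum ?big_seq1 //.
apply: uniq_perm => // [|z]; first exact: fset_uniq.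
by rewrite mem_seq1; apply/fset1P/eqP.
Qed.

Lemma lower_fset w (A : {fset W * int}) :
  (forall q, q \in A -> (q.1 < w)%O) -> lower w (tsum (enum_fset A)).
Proof. by move=> H; exists (enum_fset A). Qed.

Lemma seq_max (s : seq (W * int)) : s != [::] ->
  exists2 q, q \in s & forall q', q' \in s -> (q'.1 <= q.1)%O.
Proof.
elim: s => // q s IH _; have [->|/IH[q' q's H]] := eqVneq s [::].
  by exists q => [|q']; rewrite mem_seq1 // => /eqP ->.
have [le|lt] := leP q.1 q'.1.
  exists q'; first by rewrite in_cons q's orbT.
  by move=> z; rewrite in_cons => /orP[/eqP ->|/H].
exists q; first by rewrite mem_head.
move=> z; rewrite in_cons => /orP[/eqP ->//|/H zq]; apply: ltW; exact: le_lt_trans lt.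
Qed.

Lemma tsum_top (s : seq (W * int)) w : (forall q, q \in s -> (q.1 <= w)%O) ->
  exists m, lower w (tsum s - gen w *~ m).
Proof.
elim: s => [|q s IH] H.
  by exists 0; rewrite mulr0z subr0 /tsum big_nil; exact: lower0.
have [|m l] := IH; first by move=> z zs; apply: H; rewrite in_cons zs orbT.
have : (q.1 <= w)%O by apply: H; rewrite mem_head.
rewrite le_eqVlt => /orP[/eqP qw|qw].
  exists (q.2 + m); rewrite /tsum big_cons -/(tsum s) /term qw mulrzDr.
  by rewrite [gen w *~ q.2 + tsum s]addrC addrKA.
exists m; rewrite /tsum big_cons -/(tsum s) -addrA; apply: lowerD => //.
by exists [:: q]; [move=> z; rewrite mem_seq1 => /eqP ->|rewrite /tsum big_seq1].
Qed.

(** Subtract from g the chosen multiple of the highest generator and continue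
    with the remainder, which involves lower generators only. *)
Lemma normal_below w g m : lower w (g - gen w *~ m) ->
  exists F, [/\ normal F, forall q, q \in F -> (q.1 <= w)%O & tsum (enum_fset F) = g].
Proof.
elim: (wfW w) g m => {}w _ IH g m l.
have low h : lower w h -> exists F, [/\ normal F, forall q, q \in F -> (q.1 < w)%O & tsum (enum_fset F) = h].
  move=> [s Hs ->]; have [->|/seq_max[q qs qmax]] := eqVneq s [::].
    by exists fset0.
  have [n ln] := tsum_top qmax.
  have [F [nF HF tF]] := IH _ (Hs _ qs) _ _ ln.
  by exists F; split=> // z /HF zq; apply: le_lt_trans zq _; exact: Hs.
have lc : lower w (g - gen w *~ coeff w g).
  by rewrite /coeff; case: xgetP => // /(_ m).
have [lt|nlt] := pselect (lower w (gen w *~ coeff w g)).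
  have [|F [nF HF tF]] := low g.
    by rewrite -(subrK (gen w *~ coeff w g) g); exact: lowerD.
  by exists F; split=> // q /HF/ltW.
have [F [[nF1 nF2] HF tF]] := low _ lc.
exists ([fset (w, coeff w g)] `|` F)%fset; split.
- split=> [q /fsetUP[/fset1P ->|]|q q' /fsetUP[/fset1P ->|qF] /fsetUP[/fset1P ->|q'F]] //=.
  + by split=> //; rewrite /term /=; symmetry; apply: coeff_coset.
  + exact: nF1.
  + by move=> E; have := HF _ q'F; rewrite -E ltxx.
  + by move=> E; have := HF _ qF; rewrite E ltxx.
  + exact: nF2.
- by move=> q /fsetUP[/fset1P ->//|/HF/ltW].
- rewrite tsum_fsetU ?tsum_fset1 ?tF; first by rewrite addrC subrK.
  by move=> q /fset1P -> /HF; rewrite ltxx.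
Qed.

Lemma normal_exists g : exists F, normal F /\ tsum (enum_fset F) = g.
Proof.
have [w gw] := gen_surj g.
have [|F [nF _ tF]] := @normal_below w g 1; last by exists F.
by rewrite mulr1z gw subrr; exact: lower0.
Qed.

Lemma tsum_fsetID (A B : {fset W * int}) :
  tsum (enum_fset A) = tsum (enum_fset (A `&` B)%fset) + tsum (enum_fset (A `\` B)%fset).
Proof.
rewrite -tsum_fsetU ?fsetID // => q /fsetIP[_ qB] /fsetDP[_].
by rewrite qB.
Qed.

(** At the highest generator where A and B differ, the terms of A and of B
    agree modulo lower generators, so their coefficients are equal. *)
Lemma normal_top (A B : {fset W * int}) q : normal A -> normal B ->
  q \in A -> q \notin B ->
  tsum (enum_fset (A `\` B)%fset) = tsum (enum_fset (B `\` A)%fset) ->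
  (forall z, z \in (A `\` B)%fset -> (z.1 <= q.1)%O) ->
  (forall z, z \in (B `\` A)%fset -> (z.1 <= q.1)%O) -> False.
Proof.
move=> [nA1 nA2] [nB1 nB2] qA qB E HA HB.
have qAB : q \in (A `\` B)%fset by apply/fsetDP.
have EA : tsum (enum_fset (A `\` B)%fset) = term q + tsum (enum_fset ((A `\` B) `\ q)%fset).
  rewrite (tsum_fsetID _ [fset q]%fset) -tsum_fset1; congr (tsum (enum_fset _) + _).
  by apply/fsetP => z; rewrite in_fsetI in_fset1; case: eqP => [->|_]; rewrite ?qAB ?andbF.
have lA : lower q.1 (tsum (enum_fset ((A `\` B) `\ q)%fset)).
  apply: lower_fset => z /fsetD1P[zq zAB]; rewrite lt_neqAle HA // andbT.
  by apply: contra zq => /eqP h; apply/eqP/nA2 => //; case/fsetDP: zAB.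
have [nl cq] := nA1 _ qA.
have [[z zBA zq]|nz] := pselect (exists2 z, z \in (B `\` A)%fset & z.1 = q.1); last first.
  apply: nl; have -> : term q = tsum (enum_fset (B `\` A)%fset) - tsum (enum_fset ((A `\` B) `\ q)%fset).
    by rewrite -E EA addrK.
  apply: lowerB => //; apply: lower_fset => z zBA; rewrite lt_neqAle HB // andbT.
  by apply/eqP => h; apply: nz; exists z.
have [zB zA] : z \in B /\ z \notin A by case/fsetDP: zBA.
have EB : tsum (enum_fset (B `\` A)%fset) = term z + tsum (enum_fset ((B `\` A) `\ z)%fset).
  rewrite (tsum_fsetID _ [fset z]%fset) -tsum_fset1; congr (tsum (enum_fset _) + _).
  by apply/fsetP => t; rewrite in_fsetI in_fset1; case: eqP => [->|_]; rewrite ?zBA ?andbF.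
have lB : lower q.1 (tsum (enum_fset ((B `\` A) `\ z)%fset)).
  apply: lower_fset => t /fsetD1P[tz tBA]; rewrite lt_neqAle HB // andbT.
  by apply: contra tz => /eqP h; apply/eqP/nB2; rewrite ?zq //; case/fsetDP: tBA.
have [_ cz] := nB1 _ zB.
suff qz : q = z by rewrite qz zB in qB.
have : coeff q.1 (term q) = coeff q.1 (term z).
  apply: coeff_coset.
  have -> : term q - term z = tsum (enum_fset ((B `\` A) `\ z)%fset) - tsum (enum_fset ((A `\` B) `\ q)%fset).
    rewrite -[term q](addrK (tsum (enum_fset ((A `\` B) `\ q)%fset))) -EA E EB.
    by rewrite addrAC [term z + _]addrC addrK.
  exact: lowerB.
rewrite cq -zq cz => h; move: zq h; clear; case: q z => [a b] [a' b'] /= -> ->.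
by [].
Qed.

Lemma normal_unique A B : normal A -> normal B ->
  tsum (enum_fset A) = tsum (enum_fset B) -> A = B.
Proof.
move=> nA nB E.
have E' : tsum (enum_fset (A `\` B)%fset) = tsum (enum_fset (B `\` A)%fset).
  apply: (@addrI _ (tsum (enum_fset (A `&` B)%fset))).
  by rewrite -tsum_fsetID {1}fsetIC -tsum_fsetID.
pose s := (enum_fset (A `\` B)%fset ++ enum_fset (B `\` A)%fset).
have [s0|/seq_max[q]] := eqVneq s [::].
  apply/fsetP => z; apply/idP/idP => zA; apply/negPn/negP => nz.
    have : z \in s by rewrite mem_cat; apply/orP; left; apply/fsetDP.
    by rewrite s0.
  have : z \in s by rewrite mem_cat; apply/orP; right; apply/fsetDP.
  by rewrite s0.
have inA z : z \in (A `\` B)%fset -> z \in s by move=> h; rewrite mem_cat h.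
have inB z : z \in (B `\` A)%fset -> z \in s by move=> h; rewrite mem_cat h orbT.
rewrite mem_cat => /orP[/fsetDP[qA qB]|/fsetDP[qB qA]] mx.
  by case: (@normal_top A B q) => // z /[dup]; [move=> /inA/mx|move=> /inB/mx].
by case: (@normal_top B A q) => // z /[dup]; [move=> /inB/mx|move=> /inA/mx].
Qed.

End NormalForm.

(** * From ordinals to the group *)

Section Thinning.
Context {d d' : Order.disp_t} {O : orderType d} {W : orderType d'}.
Context (hO : omega1_like O) (wfW : wf_order W).
Local Open Scope order_scope.
Local Open Scope classical_set_scope.

Lemma constant_part T (A : set T) (f : O -> T) : countable A -> (forall x, A (f x)) ->
  exists phi t, increasing phi /\ forall x, f (phi x) = t.
Proof.
move=> cA fA; have [t _ st] := stat_pigeonhole hO cA (statT hO) (fun x _ => fA x).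
have [phi [iphi H]] := increasing_enum hO (stat_uncountable hO st).
by exists phi, t; split=> // x; have [] := H x.
Qed.

(** Below the least w with uncountably many values below it, each value has
    countably many values below it. *)
Lemma increasing_part (u : O -> W) : injective u ->
  exists2 phi, increasing phi & forall x y, x < y -> u (phi x) < u (phi y).
Proof.
move=> uinj.
have [A ncA HA] : exists2 A : set O, ~ countable A &
    forall a, A a -> countable [set b | A b /\ u b < u a].
  pose B := [set w | ~ countable [set a | u a < w]].
  have [[w0 Bw0]|nB] := pselect (B !=set0); last first.
    exists setT => [|a _]; first by case: hO.
    apply: contrapT => nc; apply: nB; exists (u a) => cc; apply: nc.
    by apply: sub_countable cc; apply: subset_card_le => b [].
  have [w Bw wmin] := wf_min wfW (ex_intro _ w0 Bw0 : B !=set0).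
  exists [set a | u a < w] => // a aw.
  apply: contrapT => nc; have /wmin : B (u a).
    move=> cc; apply: nc; apply: sub_countable cc.
    by apply: subset_card_le => b [].
  by rewrite leNgt aw.
have [phi [iphi Aphi]] := increasing_enum hO ncA.
have [|psi ipsi H] := @free_increasing _ _ hO (fun x y => x < y /\ u (phi y) <= u (phi x)).
  move=> x; apply: (@inj_countable _ _ phi _ [set b | A b /\ u b < u (phi x)]).
  - exact: HA.
  - move=> y [xy]; rewrite le_eqVlt => /orP[/eqP/uinj/(increasing_injective iphi) E|//].
    by rewrite E ltxx in xy.
  - by move=> y z _ _; exact: increasing_injective.
exists (phi \o psi) => [x y /ipsi /iphi //|x y xy].
by rewrite ltNge; apply/negP => le; apply: (H x y xy); split=> //; exact: ipsi.
Qed.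

Lemma increasing_family k (u : 'I_k -> O -> W) : (forall j, injective (u j)) ->
  exists2 phi, increasing phi & forall j x y, x < y -> u j (phi x) < u j (phi y).
Proof.
move=> iu.
suff H n : exists2 phi, increasing phi &
    forall j : 'I_k, (j < n)%N -> forall x y, x < y -> u j (phi x) < u j (phi y).
  by have [phi iphi Hphi] := H k; exists phi => // j; exact: Hphi.
elim: n => [|n [phi iphi IH]]; first by exists id.
have [nk|kn] := ltnP n k; last first.
  by exists phi => // j _; apply: IH; exact: leq_trans kn.
pose j0 := Ordinal nk.
have [|psi ipsi tpsi] := @increasing_part (u j0 \o phi).
  by move=> x y /iu; exact: increasing_injective.
exists (phi \o psi) => [x y /ipsi/iphi //|j].
rewrite ltnS leq_eqVlt => /orP[/eqP jn|jn] x y xy.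
  have -> : j = j0 by exact: val_inj.
  exact: tpsi.
by apply: (IH j jn); exact: ipsi.
Qed.

(** Induction on the common size of the sets.  Either some w belongs to
    uncountably many of them and can be removed, or each set meets only
    countably many others and [free_increasing] makes them disjoint. *)
Lemma delta_system (T : choiceType) (s : O -> {fset T}) :
  exists phi R, increasing phi /\ forall a b, a != b -> (s (phi a) `&` s (phi b))%fset = R.
Proof.
have [phi0 [n [iphi0 Hn]]] := @constant_part _ setT (fun a => #|` s a|%fset) (countableP _) (fun _ => I).
suff H m (t : O -> {fset T}) : (forall a, #|` t a|%fset = m) ->
    exists phi R, increasing phi /\ forall a b, a != b -> (t (phi a) `&` t (phi b))%fset = R.
  have [phi [R [ip H']]] := H n (s \o phi0) Hn.
  by exists (phi0 \o phi), R; split=> // x y /ip/iphi0.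
elim: m t => {s phi0 n iphi0 Hn} [|n IH] s Hs.
  exists id, fset0; split=> // a b _; have /eqP := Hs a.
  by rewrite cardfs_eq0 => /eqP ->; rewrite fset0I.
have [[w ncw]|H] := pselect (exists w, ~ countable [set a | w \in s a]).
  have [phi [iphi wphi]] := increasing_enum hO ncw.
  have [|psi [R [ipsi HR]]] := IH (fun a => s (phi a) `\ w)%fset.
    by move=> a; have := Hs (phi a); rewrite (cardfsD1 w) (wphi a : _ = true) => -[].
  exists (phi \o psi), (w |` R)%fset; split=> [x y /ipsi/iphi //|a b ab].
  rewrite -(HR a b ab); apply/fsetP => z; rewrite !inE.
  have [->|_] := eqVneq z w; last by [].
  by rewrite (wphi (psi a) : _ = true) (wphi (psi b) : _ = true).
have [|phi iphi Hphi] := @free_increasing _ _ hO (fun a b => (s a `&` s b)%fset != fset0).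
  move=> a; apply: (@sub_countable _ _ _ (\bigcup_(w in [set` s a]) [set b | w \in s b])).
    apply: subset_card_le => b /fset0Pn[w]; rewrite inE => /andP[wa wb].
    by exists w.
  apply: bigcup_countable => [|w _]; first exact: countable_fset.
  by apply: contrapT => nc; apply: H; exists w.
exists phi, fset0; split=> // a b ab; apply/eqP/negPn/negP => ne.
case: (ltgtP a b) => [lt|lt|E]; [exact: (Hphi _ _ lt)| |by rewrite E eqxx in ab].
by apply: (Hphi _ _ lt); rewrite fsetIC.
Qed.

Lemma agree_separates (r : W -> nat -> bool) (l : seq W) :
  (forall a b, (forall n, r a n = r b n) -> a = b) ->
  exists m, forall a b, a \in l -> b \in l -> agree r m a b -> a = b.
Proof.
move=> r_inj; exists (\max_(a <- l) \max_(b <- l) (delta r a b).+1)%N => a b al bl ag.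
apply: contrapT => ab; have := (delta_agree r_inj _ ab).1 ag; rewrite leqNgt => /negP; apply.
apply: leq_trans (_ : \max_(b <- l) (delta r a b).+1 <= _)%N.
  exact: (@leq_bigmax_seq _ _ xpredT (fun b => (delta r a b).+1)).
exact: (@leq_bigmax_seq _ _ xpredT (fun a => \max_(b <- l) (delta r a b).+1)%N).
Qed.

End Thinning.

Section GroupColouring.
Context {d d' : Order.disp_t} {O : orderType d} {W : orderType d'}.
Context (hO : omega1_like O) (hW : omega2_like O W).
Context (r : W -> nat -> bool).
Hypothesis r_inj : forall a b, (forall n, r a n = r b n) -> a = b.
Context (G : zmodType) (gen : W -> G).
Hypothesis gen_surj : forall g, exists w, gen w = g.
Local Open Scope ring_scope.

Let wfW : wf_order W := hW.1.

Definition support (F : {fset W * int}) : {fset W} := [fset q.1 | q in F]%fset.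

Lemma supportP F w : reflect (exists2 q, q \in F & w = q.1) (w \in support F).
Proof. by apply: (iffP (imfsetP _ _ _ _)) => -[q qF ->]; exists q. Qed.

Lemma normal_sub A B : (A `<=` B)%fset -> normal gen B -> normal gen A.
Proof.
move=> /fsubsetP AB [H1 H2]; split=> [q /AB/H1 //|q q' /AB qB /AB q'B].
exact: H2.
Qed.

Lemma normal_fsetU A B : normal gen A -> normal gen B ->
  (forall w, w \in support A -> w \in support B -> False) ->
  normal gen (A `|` B)%fset /\
  tsum gen (enum_fset (A `|` B)%fset) = tsum gen (enum_fset A) + tsum gen (enum_fset B).
Proof.
move=> [A1 A2] [B1 B2] dis; split.
  split=> [q /fsetUP[/A1|/B1] //|q q' /fsetUP[qA|qB] /fsetUP[q'A|q'B] E].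
  - exact: A2.
  - by case: (dis q.1); [apply/supportP; exists q|apply/supportP; exists q'].
  - by case: (dis q.1); [apply/supportP; exists q'|apply/supportP; exists q].
  - exact: B2.
apply: tsum_fsetU => q qA qB.
by apply: (dis q.1); apply/supportP; exists q.
Qed.

Lemma support_fsetU A B w : w \in support (A `|` B)%fset = (w \in support A) || (w \in support B).
Proof.
apply/supportP/orP => [[q /fsetUP[qA|qB] ->]|[/supportP[q qA ->]|/supportP[q qB ->]]].
- by left; apply/supportP; exists q.
- by right; apply/supportP; exists q.
- by exists q => //; apply/fsetUP; left.
- by exists q => //; apply/fsetUP; right.
Qed.

(** All thinning is done on sequences indexed by omega_1: to a Delta-system of
    supports, with the same part on the root, tails that avoid the support R of
    three times that part, tails of the same size k, and tails whose reals have
    the same pairwise different prefixes of length N. *)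
Theorem group_colouring : exists c : G -> nat, forall f : O -> G, injective f ->
  forall i, exists a b e, [/\ a != b, b != e & a != e] /\ c (f a + f b + f e) = i.
Proof.
have [rho hrho] := subadditive_exists hO hW.
have [p hp] := rank_exists hO hW hrho.
have [mu hmu] := marker_colouring hO.
have /choice[nf Hnf] := normal_exists wfW gen_surj.
have nf_uniq F g : normal gen F -> tsum gen (enum_fset F) = g -> nf g = F.
  by move=> nF <-; apply: (normal_unique (gen := gen)) => //; [exact: (Hnf _).1|exact: (Hnf _).2].
exists (fun g => decode r (triple_colour rho p mu) [set` support (nf g)]) => f finj i.
have [w0 _] : exists w : W, True by have [w _] := gen_surj 0; exists w.
have [o _] := omega1_pt hO.
have [phi1 [R0 [iphi1 HR0]]] := delta_system hO (fun a => support (nf (f a))).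
pose D := [set q : W * int | q.1 \in R0].
have cD : countable D.
  apply: (@sub_countable _ _ _ ([set` R0] `*` [set: int])).
    by apply: subset_card_le => q.
  by apply: countableX => //; exact: countable_fset.
have [|phi2 [C [iphi2 HC]]] := @constant_part _ _ hO _ _
  (fun a => [set q | q \in nf (f (phi1 a)) /\ q.1 \in R0]) (countable_finite_subset cD).
  move=> a; split=> [q []//|].
  by apply: sub_finite_set (finite_fset (nf (f (phi1 a)))) => q [].
pose g a := f (phi1 (phi2 a)).
have ginj : injective g.
  by move=> a b /finj/(increasing_injective iphi1)/(increasing_injective iphi2).
have disj a b w : a != b -> w \in support (nf (g a)) -> w \in support (nf (g b)) -> w \in R0.
  move=> ab wa wb; rewrite -(HR0 (phi2 a) (phi2 b)); first exact/fsetIP.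
  by apply: contra ab => /eqP/(increasing_injective iphi2) ->.
pose head a := [fset q in nf (g a) | q.1 \in R0]%fset.
pose tail a := [fset q in nf (g a) | q.1 \notin R0]%fset.
have headE a : head a = head o.
  apply/fsetP => q; rewrite !inE /=; apply/idP/idP => /andP[qa qR].
    have : C q by rewrite -(HC a).
    by rewrite -(HC o) => -[-> ->].
  have : C q by rewrite -(HC o).
  by rewrite -(HC a) => -[-> ->].
have tailR a w : w \in support (tail a) -> w \in support (nf (g a)) /\ w \notin R0.
  move=> /supportP[q]; rewrite !inE /= => /andP[qa qR] ->; split=> //.
  by apply/supportP; exists q.
have gE a : g a = tsum gen (enum_fset (head o)) + tsum gen (enum_fset (tail a)).
  rewrite -[LHS](Hnf (g a)).2 -(headE a) -tsum_fsetU.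
    congr (tsum gen (enum_fset _)); apply/fsetP => q; rewrite !inE /= -andb_orr.
    by rewrite orbN andbT.
  by move=> q; rewrite !inE /= => /andP[_ qR] /andP[_]; rewrite qR.
have tail_normal a : normal gen (tail a).
  apply: normal_sub (Hnf (g a)).1; apply/fsubsetP => q.
  by rewrite !inE /= => /andP[].
pose base := tsum gen (enum_fset (head o)).
pose R := nf (base + base + base).
pose s a := support (tail a).
have sdisj a b w : a != b -> w \in s a -> w \in s b -> False.
  move=> ab /tailR[wa nR] /tailR[wb _]; by rewrite (disj a b) in nR.
(* countably many tails meet the support of R, and at most one is empty *)
have nc : ~ countable [set a | s a != fset0 /\ forall w, w \in s a -> w \notin support R].
  move=> cc; have ncO : ~ countable [set: O] by case: hO.
  apply: ncO; apply: (@sub_countable _ _ _ (\bigcup_(z in [set: option bool])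
     match z with None => [set a | s a != fset0 /\ forall w, w \in s a -> w \notin support R]
        | Some true => [set a | s a = fset0]
        | Some false => [set a | exists2 w, w \in s a & w \in support R] end)).
    apply: subset_card_le => a _.
    have [sa|sa] := eqVneq (s a) fset0; first by exists (Some true).
    have [[w wa wR]|H] := pselect (exists2 w, w \in s a & w \in support R).
      by exists (Some false) => //; exists w.
    exists None => //; split=> // w wa; apply/negP => wR; apply: H; by exists w.
  apply: bigcup_countable => // -[[]|] _ //.
    apply: (@inj_countable _ _ (fun=> tt) _ setT) => // a b sa sb _.
    apply: ginj; rewrite !gE; congr (_ + tsum gen (enum_fset _)).
    have E e : s e = fset0 -> tail e = fset0.
      move=> se; apply/eqP; rewrite -[_ == _]negbK; apply/negP => /fset0Pn[q qe].
      have : q.1 \in s e by apply/supportP; exists q.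
      by rewrite se in_fset0.
    by rewrite (E a) // (E b).
  apply: (@sub_countable _ _ _ (\bigcup_(w in [set` support R]) [set a | w \in s a])).
    by apply: subset_card_le => a [w wa wR]; exists w.
  apply: bigcup_countable => [|w _]; first exact: countable_fset.
  apply: (@inj_countable _ _ (fun=> tt) _ setT) => // a b /= wa wb _.
  by apply/eqP/negPn/negP => ab; exact: (sdisj a b w).
have [phi3 [iphi3 H3]] := increasing_enum hO nc.
have [phi4 [k [iphi4 Hk]]] := @constant_part _ _ hO _ setT (fun a => #|` s (phi3 a)|%fset)
   (countableP _) (fun _ => I).
pose psi a := phi3 (phi4 a).
have k0 : (0 < k)%N.
  by rewrite -(Hk o) cardfs_gt0; case: (H3 (phi4 o)).
have /choice[m Hm] : forall a, exists m, forall w z, w \in support R ++ s (psi a) ->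
    z \in support R ++ s (psi a) -> agree r m w z -> w = z.
  by move=> a; exact: agree_separates.
pose x a (j : 'I_k) := nth w0 (enum_fset (s (psi a))) j.
have sz a : size (enum_fset (s (psi a))) = k by exact: Hk.
have xs a j : x a j \in s (psi a) by apply: mem_nth; rewrite sz.
have xinj a j j' : x a j = x a j' -> j = j'.
  by move=> /eqP; rewrite nth_uniq ?fset_uniq ?sz // => /eqP/val_inj.
have x_onto a w : w \in s (psi a) -> exists j, x a j = w.
  move=> ws; have lt : (index w (enum_fset (s (psi a))) < k)%N by rewrite -(sz a) index_mem.
  by exists (Ordinal lt); rewrite /x /= nth_index.
have psi_inj a b : psi a = psi b -> a = b.
  by move=> /(increasing_injective iphi3)/(increasing_injective iphi4).
have x_disj a b j j' : x a j = x b j' -> a = b.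
  move=> E; apply/eqP/negPn/negP => ab; apply: (sdisj (psi a) (psi b) (x a j)) => //.
    by apply: contra ab => /eqP/psi_inj ->.
  by rewrite E.
have xR a j : x a j \notin support R by case: (H3 (phi4 a)) => _; apply; exact: xs.
have [phi5 [[N tau] [iphi5 H5]]] := @constant_part _ _ hO _ setT
  (fun a => (m a, [ffun j => code r (x a j) (m a)])) (countableP _) (fun _ => I).
have mN a : m (phi5 a) = N by have [] := H5 a.
have same a b j : agree r N (x (phi5 a) j) (x (phi5 b) j).
  have [_ /ffunP/(_ j)] := H5 a; have [_ /ffunP/(_ j)] := H5 b.
  rewrite !ffunE !mN => <- E; by have [_] := code_eq E.
have sep a w z : w \in support R ++ s (psi (phi5 a)) -> z \in support R ++ s (psi (phi5 a)) ->
    agree r N w z -> w = z.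
  by rewrite -(mN a); exact: Hm.
have [|phi6 iphi6 H6] := @increasing_family _ _ _ _ hO wfW k (fun j a => x (phi5 a) j).
  by move=> j a b /x_disj; exact: increasing_injective.
pose y a := x (phi5 (phi6 a)).
have [|w z|a e j|a e j|a b j j' jj'|a [b [e [[ab be ae] E]]]] :=
  @all_colours _ _ _ _ hO hW rho hrho p hp mu hmu r r_inj k k0 [set` support R] y N _ _ _ _ _ i.
- by move=> j a b; exact: H6.
- by move=> wR zR; apply: (sep o); rewrite mem_cat; apply/orP; left.
- move=> aR ag; have := xR (phi5 (phi6 e)) j.
  suff <- : a = x (phi5 (phi6 e)) j by rewrite [_ \in _]aR.
  by apply: (sep (phi6 e)) ag; rewrite mem_cat ?xs ?orbT //; apply/orP; left.
- exact: same.
- move=> ag; case/eqP: jj'; apply: (xinj (phi5 (phi6 a))).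
  apply: (sep (phi6 a)); rewrite ?mem_cat ?xs ?orbT //.
  by apply: agree_trans ag _; exact: same.
pose h t := psi (phi5 (phi6 t)).
have h_inj t t' : h t = h t' -> t = t'.
  by move=> /psi_inj/(increasing_injective iphi5)/(increasing_injective iphi6).
have hne t t' : t != t' -> h t != h t' by apply: contra => /eqP/h_inj ->.
exists (phi1 (phi2 (h a))), (phi1 (phi2 (h b))), (phi1 (phi2 (h e))).
have ne t t' : t != t' -> phi1 (phi2 (h t)) != phi1 (phi2 (h t')).
  by apply: contra => /eqP/(increasing_injective iphi1)/(increasing_injective iphi2)/h_inj ->.
split; first by split; exact: ne.
rewrite -[RHS]E; congr (decode _ _ _).
have disR t w : w \in support R -> w \in s (h t) -> False.
  by move=> wR /x_onto[j wE]; have := xR (phi5 (phi6 t)) j; rewrite wE wR.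
have [n1 t1] := normal_fsetU (Hnf (base + base + base)).1 (tail_normal (h a)) (@disR a).
have [|n2 t2] := normal_fsetU n1 (tail_normal (h b)).
  move=> w; rewrite support_fsetU => /orP[wR|wa] wb; first exact: (disR b w).
  exact: (sdisj _ _ _ (hne _ _ ab) wa wb).
have [|n3 t3] := normal_fsetU n2 (tail_normal (h e)).
  move=> w; rewrite !support_fsetU -orbA => /or3P[wR|wa|wb] we; first exact: (disR e w).
    exact: (sdisj _ _ _ (hne _ _ ae) wa we).
  exact: (sdisj _ _ _ (hne _ _ be) wb we).
have rangeE t : range (y t) = [set` s (h t)].
  apply/seteqP; split => [_ [j _ <-]|w ws]; first exact: xs.
  by have [j wE] := x_onto _ _ ws; exists j.
rewrite -/(g (h a)) -/(g (h b)) -/(g (h e)) (nf_uniq _ _ n3); last first.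
  rewrite t3 t2 t1 (Hnf _).2 !gE -/base.
  by rewrite [base + _ + (base + _)]addrACA [RHS]addrACA !addrA.
rewrite !rangeE; apply/seteqP; split => [w|w] /=; rewrite !support_fsetU.
  by rewrite -!orbA => /or4P[H|H|H|H]; [do 3!left|do 2!left; right|left; right|right].
by move=> [[[->|->]|->]|->]; rewrite ?orbT.
Qed.

End GroupColouring.

(** * Well-orders from cardinalities *)

Local Open Scope card_scope.

Lemma card_le_inj T U (A : set T) (B : set U) (u0 : U) : A #<= B <->
  exists f : T -> U, (forall x, A x -> B (f x)) /\
    forall x y, A x -> A y -> f x = f y -> x = y.
Proof.
pose U' : pointedType := HB.pack {classic U} (isPointed.Build {classic U} u0).
split=> [/(@pcard_leP T U')/injfunPex[f fAB finj]|[f [fAB finj]]].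
  by exists f; split=> // x y Ax Ay; apply: finj; rewrite inE.
apply/(@pcard_leP T U')/injfunPex; exists f => // x y.
by rewrite !inE; exact: finj.
Qed.

Definition linear (T : Type) (R : rel T) : Prop :=
  [/\ reflexive R, antisymmetric R, transitive R & total R].

(** An alias of T, so that order instances can be attached to each R. *)
Definition ordered_by (T : Type) (R : rel T) (linR : linear R) : Type := T.

Section OrderedBy.
Context (T : Type) (R : rel T) (linR : linear R).
Local Notation E := (ordered_by linR).
HB.instance Definition _ := gen_eqMixin E.
HB.instance Definition _ := gen_choiceMixin E.
Let R_refl : reflexive (R : rel E). Proof. by case: linR. Qed.
Let R_anti : antisymmetric (R : rel E). Proof. by case: linR. Qed.
Let R_trans : transitive (R : rel E). Proof. by case: linR. Qed.
HB.instance Definition _ :=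
  Order.Le_isPOrder.Build (Order.Disp tt tt) E R_refl R_anti R_trans.
Let R_total : total (<=%O : rel E). Proof. by case: linR. Qed.
HB.instance Definition _ := Order.POrder_isTotal.Build (Order.Disp tt tt) E R_total.

Lemma ordered_by_le (x y : E) : (x <= y)%O = R x y.
Proof. by []. Qed.
End OrderedBy.

Lemma well_ordered_type (T : Type) : exists (R : rel T) (linR : linear R), wf_order (ordered_by linR).
Proof.
have [R woR] := wochoice.well_ordering_principle {classic T}.
have ch : wochoice.wo_chain R predT by move=> A _; exact: woR.
have linR : @linear T R.
  split.
  - by move=> x; exact: (wochoice.wo_chain_reflexive ch).
  - by move=> x y; exact: (wochoice.wo_chain_antisymmetric ch).
  - move=> y x z xy yz.
    have tot := wochoice.wo_chainW ch; have anti := wochoice.wo_chain_antisymmetric ch.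
    have [|m [[mA mmin] _]] :=
        woR [pred t : {classic T} | t \in ([:: x; y; z] : seq {classic T})].
      by exists x; rewrite !inE eqxx.
    move: mA; rewrite !inE => /or3P[] /eqP mE; subst m.
    + by apply: mmin; rewrite !inE eqxx !orbT.
    + have E : y = x by apply: anti => //; rewrite xy mmin // !inE eqxx.
      by rewrite -E.
    + have E : z = y by apply: anti => //; rewrite yz mmin // !inE eqxx orbT.
      by rewrite E.
  - by move=> x y; exact: (wochoice.wo_chainW ch).
exists R, linR => x; apply: contrapT => nacc.
have [|m [[mA mmin] _]] := woR [pred t : {classic T} |
    `[< ~ Acc (fun x y : ordered_by linR => (x < y)%O) t >]].
  by exists x; apply/asboolP.
move: mA => /asboolP; apply; constructor => y ym; apply: contrapT => ny.
have : (m <= y :> ordered_by linR)%O by apply: mmin; apply/asboolP.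
by rewrite leNgt ym.
Qed.

(** If a proper initial segment of a well-order of T is as large as T, the
    shortest such segment is in bijection with T and has no such segment. *)
Lemma initial_order (T : Type) : exists (R : rel T) (linR : linear R),
  wf_order (ordered_by linR) /\
  forall c : ordered_by linR, ~ ([set: T] #<= [set x | (x < c)%O]).
Proof.
have [R0 [lin0 wf0]] := well_ordered_type T.
pose W0 := ordered_by lin0.
pose big := [set c : W0 | [set: T] #<= [set x | (x < c)%O]].
have [[c0 bc0]|nb] := pselect (big !=set0); last first.
  by exists R0, lin0; split=> // c bc; apply: nb; exists c.
have [c bc cmin] := wf_min wf0 (ex_intro _ c0 bc0 : big !=set0).
have [f [fc finj]] := (card_le_inj [set: T] [set x | (x < c)%O] c).1 bc.
pose R : rel T := fun x y => (f x <= f y)%O.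
have linR : linear R.
  split; rewrite /R.
  - by move=> x; exact: lexx.
  - by move=> x y /le_anti; exact: finj.
  - by move=> x y z; exact: le_trans.
  - by move=> x y; exact: le_total.
have ltE (x y : ordered_by linR) : (x < y)%O -> (f x < f y)%O.
  by rewrite !ltNge ordered_by_le.
exists R, linR; split.
  move=> x; have [w wE] : exists w, w = f x by exists (f x).
  elim: (wf0 w) x wE => {}w _ IH x wE; constructor => y /ltE lt.
  by apply: (IH (f y)) => //; rewrite wE.
move=> e be; have : big (f e).
  apply: card_le_trans be _; apply/(card_le_inj _ _ c); exists f; split.
    by move=> x; exact: ltE.
  by move=> x y _ _; exact: finj.
by move=> /cmin; rewrite leNgt fc.
Qed.

(** Enumerate C along O without repetition, as long as possible. *)
Lemma card_comparable d (O : orderType d) (wfO : wf_order O) T (C : set T) :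
  (exists f : O -> T, (forall x, C (f x)) /\ injective f) \/ C #<= [set: O].
Proof.
have [[t0 Ct0]|nC] := pselect (C !=set0); last first.
  right; suff -> : C = set0 by exact: card_ge0.
  by rewrite -subset0 => x Cx; apply: nC; exists x.
have [f Hf] := wf_fix wfO (fun x (r : forall y, (y < x)%O -> {classic T}) =>
  xget (t0 : {classic T}) [set t | C t /\ forall y (yx : (y < x)%O), r y yx <> t]).
have [H|] := pselect (forall x, exists t, C t /\ forall y, (y < x)%O -> f y <> t).
  left; exists f; have P x : C (f x) /\ forall y, (y < x)%O -> f y <> f x.
    rewrite [f x]Hf; case: xgetP => [t _ //|nx].
    by have [t Ht] := H x; case: (nx t).
  split=> [x|x y E]; first by case: (P x).
  by case: (ltgtP x y) => // lt; [case: ((P y).2 x lt)|case: ((P x).2 y lt)].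
move=> /existsNP[x Hx]; right.
apply: (@card_le_trans _ _ _ (f @` [set y | (y < x)%O])); last first.
  by apply: card_le_trans (card_image_le _ _) _; exact: card_leT.
apply: subset_card_le => t Ct; apply: contrapT => nt; apply: Hx; exists t; split=> // y yx E.
by apply: nt; exists y.
Qed.

Lemma aleph0_lt T U (N : set T) (X : set U) : N #= [set: nat] -> ~ countable X -> card_lt N X.
Proof.
move=> /card_eqPle[N1 N2] ncX; split.
  apply: card_le_trans N1 _; apply/infiniteP => fX; apply: ncX.
  exact: finite_set_countable.
by move=> XN; apply: ncX; exact: card_le_trans N1.
Qed.

Lemma aleph1_uncountable T (B : set T) : has_aleph 1 B -> ~ countable B.
Proof.
move=> [U [N [/= /card_eqPle[N1 N2] [[_ nBN] _]]]] cB; apply: nBN.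
exact: card_le_trans cB N2.
Qed.

Lemma aleph1_le T U (B : set T) (X : set U) : has_aleph 1 B -> ~ countable X -> B #<= X.
Proof. by move=> [V [N [/= N0 [_ H]]]] ncX; apply: H; exact: aleph0_lt. Qed.

Local Open Scope ring_scope.

Theorem theoremA
    (notCH : exists (U : Type) (A : set U),
        has_aleph 1 A /\ card_lt A [set: nat -> bool])
    (G : zmodType) (hG : has_aleph 2 [set: G]) :
  exists c : G -> nat,
    forall X : set G, ~ countable X ->
    forall i : nat,
      exists x y z : G,
        [/\ X x, X y & X z] /\ [/\ x <> y, y <> z & x <> z] /\
        c (x + y + z) = i.
Proof.
have [UB [B [aB [[BG nGB] minG]]]] := hG.
have ncB := aleph1_uncountable aB.
have [RO [linO [wfO minO]]] := initial_order B.
pose O := ordered_by linO.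
have BO : B #<= [set: O] by have /card_eqPle[_] := card_setT B.
have OB : [set: O] #<= B by have /card_eqPle[] := card_setT B.
have hO : omega1_like O.
  split=> //; last by move=> cO; apply: ncB; exact: card_le_trans BO cO.
  move=> a; apply: contrapT => nc; apply: (minO a).
  exact: card_le_trans OB (aleph1_le aB nc).
have [RW [linW [wfW minW]]] := initial_order G.
pose W := ordered_by linW.
have [o _] := omega1_pt hO.
have hW : omega2_like O W.
  split=> // c; suff : [set x : W | (x < c)%O] #<= [set: O].
    move=> /(card_le_inj _ _ o)[f [_ finj]]; exists f => x y xc yc; exact: finj.
  have [[f [fC finj]]|//] := card_comparable wfO [set x : W | (x < c)%O].
  have BC : B #<= [set x : W | (x < c)%O].
    by apply: card_le_trans BO _; apply/(card_le_inj _ _ c); exists f; split=> // x y _ _; exact: finj.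
  apply: card_le_trans BO; apply: contrapT => nCB.
  by apply: (minW c); apply: minG; split.
have [r r_inj] : exists r : W -> nat -> bool, forall a b, (forall n, r a n = r b n) -> a = b.
  have [UA [A [aA [AR nRA]]]] := notCH.
  have : [set: G] #<= [set: nat -> bool].
    apply: minG; split; first exact: card_le_trans (aleph1_le aB (aleph1_uncountable aA)) AR.
    move=> RB; apply: nRA; apply: card_le_trans RB _.
    exact: aleph1_le aB (aleph1_uncountable aA).
  move=> /(card_le_inj _ _ (fun=> true))[r [_ rinj]]; exists r => a b ab.
  by apply: rinj => //; exact/funext.
have [c Hc] := @group_colouring _ _ O W hO hW r r_inj G id (fun g => ex_intro _ g erefl).
exists c => X ncX i.
have : B #<= X by exact: aleph1_le.
move=> /(card_le_trans OB)/(card_le_inj _ _ 0%R)[f [fX finj]].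
have [|a [b [e [[ab be ae] E]]]] := Hc f _ i; first by move=> x y; exact: finj.
have ne x y : x != y -> f x <> f y by move=> /eqP xy E'; apply: xy; exact: finj E'.
by exists (f a), (f b), (f e); split; [split; exact: fX|split=> //; split; exact: ne].
Qed.
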